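(* Let $r \ge 1$ be an integer, let $\lambda_1,\ldots,\lambda_r,\alpha_1,\ldots,\alpha_r \in [0,1)$, and put $\mu_i := \sum_{j=1}^{i}\lambda_j$ for $1 \le i \le r$. Let $i_1<\cdots<i_m$ (with $m\ge 1$) be the only indices $i \in \{1,\ldots,r\}$ for which $\mu_i\in\mathbb{Z}$. (1) If $i_1=1$, then $L_r(\lambda_1,\ldots,\lambda_r;\alpha_1,\ldots,\alpha_r;s_1,\ldots,s_r)$ can be meromorphically continued to $\mathbb{C}^r$ with possible simple poles along the hyperplanes $$H_{1,0}\quad\text{and}\quad H_{i_j,k}\ \text{ for } 2\le j\le m \text{ and integers } k \ge 0 \text{ with } (i_j-k)\in\mathbb{Z}_{\le j}.$$ (2) If $i_1\neq 1$, then $L_r(\lambda_1,\ldots,\lambda_r;\alpha_1,\ldots,\alpha_r;s_1,\ldots,s_r)$ can be meromorphically continued to $\mathbb{C}^r$ with possible simple poles along the hyperplanes $$H_{i_j,k}\ \text{ for } 1\le j\le m \text{ and integers } k \ge 0 \text{ with } (i_j-k)\in\mathbb{Z}_{\le j}.$$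
   Context: For $r \ge 1$ let $U_r := \{(s_1,\ldots,s_r)\in\mathbb{C}^r \mid \Re(s_1+\cdots+s_i) > i \text{ for all } 1\le i\le r\}$. For $(s_1,\ldots,s_r)\in U_r$ the multiple Lerch zeta function of depth $r$ is $$L_r(\lambda_1,\ldots,\lambda_r;\alpha_1,\ldots,\alpha_r;s_1,\ldots,s_r) := \sum_{n_1>\cdots>n_r>0}\frac{e(\lambda_1n_1)\cdots e(\lambda_rn_r)}{(n_1+\alpha_1)^{s_1}\cdots(n_r+\alpha_r)^{s_r}},$$ where the $n_i$ are integers and $e(a):=e^{2\pi\iota a}$ for $a\in\mathbb{R}$ (with $\iota=\sqrt{-1}$). The series converges normally on compact subsets of $U_r$ and defines a holomorphic function there. For integers $1\le i\le r$ and $k\ge 0$, $H_{i,k} := \{(s_1,\ldots,s_r)\in\mathbb{C}^r \mid s_1+\cdots+s_i=i-k\}$. $\mathbb{Z}_{\le j}$ denotes the set of integers less than or equal to $j$. ''Possible simple poles along'' a list of hyperplanes means that the continued function is holomorphic outside the union of the listed hyperplanes and has at most a simple pole (pole of order at most one) along each of them. *)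

(* Defs.v *)
From HB Require Import structures.
From mathcomp Require Import all_boot all_order all_algebra.
From mathcomp Require Import complex.
From mathcomp Require Import all_classical all_reals all_analysis.
From mathcomp.analysis.showcase Require summability.

Set Implicit Arguments.
Unset Strict Implicit.
Unset Printing Implicit Defensive.

Import Order.TTheory GRing.Theory Num.Theory numFieldNormedType.Exports.

Local Open Scope classical_set_scope.
Local Open Scope ring_scope.

(* Indices of variables and hyperplanes are 1-based natural numbers, whereas
   coordinates are indexed by 'I_r from 0: the first [i] coordinates are those
   with [l < i]. *)
Definition psum (K : nmodType) (r : nat) (x : 'rV[K]_r) (i : nat) : K :=
  \sum_(l < r | (l < i)%N) x 0 l.

(* Used with [K] the field [R[i]] of complex numbers over [R : realType].  The
   topology comes from the normed space structures of [K^o] and 'rV[K]_r over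
   [K], so that [differentiable] means complex (Frechet) differentiability. *)
Section SeveralComplexVariables.
Variables (K : numClosedFieldType) (r : nat).
Implicit Types (f F : 'rV[K]_r -> K^o) (s : 'rV[K]_r).

Definition holomorphic_at f s := \forall t \near s, differentiable f t.

(* Near every point, [F] is a quotient [g / h] of holomorphic functions with
   [h] nonzero as a germ; the values of [F] where [h] vanishes are
   irrelevant. *)
Definition meromorphic F := forall s, exists g h : 'rV[K]_r -> K^o,
  [/\ holomorphic_at g s, holomorphic_at h s,
      ~ (\forall t \near s, h t = 0) &
      \forall t \near s, h t != 0 -> F t = g t / h t].

Definition meromorphic_continuation (U : set 'rV[K]_r) f F :=
  meromorphic F /\ (forall s, U s -> F s = f s).

Definition hyperplane (p : nat * nat) : set 'rV[K]_r :=
  [set s | psum s p.1 = p.1%:R - p.2%:R].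

Definition hyperplane_eqn (p : nat * nat) s : K^o :=
  psum s p.1 - (p.1%:R - p.2%:R).

(* [F] is holomorphic outside the union of the hyperplanes listed in [A], and
   near every point it becomes holomorphic after multiplication by the
   equations of finitely many distinct hyperplanes of the list, each occurring
   to the first power.  This also covers the points where several hyperplanes
   meet.  For [1 <= i <= r], distinct pairs [(i, k)] are distinct
   hyperplanes. *)
Definition possible_simple_poles (A : set (nat * nat)) F :=
  (forall s, (forall p, A p -> ~ hyperplane p s) -> holomorphic_at F s) /\
  (forall s, exists (ps : seq (nat * nat)) (G : 'rV[K]_r -> K^o),
    [/\ uniq ps, (forall p, p \in ps -> A p), holomorphic_at G s &
        \forall t \near s, (forall p, A p -> ~ hyperplane p t) ->
          (\prod_(p <- ps) hyperplane_eqn p t) * F t = G t]).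

End SeveralComplexVariables.

Section MultipleLerch.
Variable R : realType.

Definition cexp (z : R[i]) : R[i] :=
  Complex (expR (complex.Re z) * cos (complex.Im z))
          (expR (complex.Re z) * sin (complex.Im z)).

(* e(a) = exp(2 pi i a) *)
Definition unit_exp (a : R) : R[i] := cexp (Complex 0 (2 * pi * a)).

(* x ^ s = exp(s log x), for [x > 0] *)
Definition cpower (x : R) (s : R[i]) : R[i] := cexp (s * Complex (ln x) 0).

(* n_1 > ... > n_r > 0 *)
Definition lerch_index (r : nat) :=
  {n : r.-tuple nat | sorted gtn n && all (ltn 0%N) n}.

Definition lerch_term (r : nat) (lam alp : 'rV[R]_r) (s : 'rV[R[i]]_r)
    (n : lerch_index r) : R[i]^o :=
  \prod_(l < r) (unit_exp (lam 0 l * (tnth (val n) l)%:R)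
                 / cpower ((tnth (val n) l)%:R + alp 0 l) (s 0 l)).

(* Unconditional sum: limit of the sums over finite subsets of the index set. *)
Definition multiple_lerch (r : nat) (lam alp : 'rV[R]_r) (s : 'rV[R[i]]_r) :
    R[i]^o :=
  summability.sum (lerch_term lam alp s).

Definition lerch_domain (r : nat) : set 'rV[R[i]]_r :=
  [set s | forall i : nat, (1 <= i <= r)%N -> i%:R < complex.Re (psum s i)].

End MultipleLerch.

(* Main.v *)
(* Induction on the depth. With zeta = e(lambda_1), solve
   P(x - 1) - zeta P(x) = zeta (x + beta)^(-s_1), beta = alpha_1 - alpha_2,
   up to an error O(x^(-s_1 - N + 1)), by
   P(x) = sum_(q < N) k_q D^(q-1) x^(-s_1), where D^(-1) is an antiderivative.
   The constants k_q are Bernoulli-like, k_0 = 0 unless zeta = 1, and D^(-1)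
   produces the only denominator, s_1 - 1. Abel summation over n_1 at
   x = n_1 + alpha_2 then gives
     L_r(s) = sum_(q < N) k_q (factor in s_1) L_(r-1)(s_1 + s_2 + q - 1, s_3, ...)
              + R_N(s),
   with first parameter lambda_1 + lambda_2 in L_(r-1), and R_N is a normally
   convergent series on a domain that exhausts C^r as N grows. On the domain of
   R_N, the difference R_N - R_(N+1) is the term q = N, with L_(r-1) evaluated
   where its series converges; so the right-hand sides for all N define one
   function on C^r. The shift by q sends the hyperplane (i, k) to
   (i + 1, k + q), which yields the list of poles. *)

(* The bound [i - k <= j] is a count. If [mu_1] is an integer, then [q = 0] occurs in the recursion
   and may raise [i] alone, but the number of integral [mu_l] with [l <= i] also rises by one.
   Otherwise [zeta <> 1], so [k_0 = 0], and [q >= 1] raises [k] together with [i]. Hence the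
   recursion preserves [i <= k + #{l <= i : mu_l integral}], and at [i = i_j] the count is [j]. The
   poles stay simple because the new denominator [s_1 - 1] has index 1 whereas all shifted
   hyperplanes have index at least 2, and because terms are added over a common denominator in which
   each hyperplane occurs once. Both cases of the theorem follow from one set of hyperplanes. Two
   uniformities carry the analysis. The error in the difference equation is bounded uniformly for
   [s_1] in a bounded set, which takes a binomial expansion with complex exponents. The nested sums
   are dominated on whole balls by sums of real powers, whose exponents come from lower bounds for
   the real parts; this yields both convergence and holomorphy of [R_N]. *)
Require Import Defs.
From HB Require Import structures.
From mathcomp Require Import all_boot all_order all_algebra.
From mathcomp Require Import complex.
From mathcomp Require Import all_classical all_reals all_analysis.
From mathcomp Require Import finmap ring lra zify.

Import Order.TTheory GRing.Theory Num.Theory numFieldNormedType.Exports.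

Local Open Scope classical_set_scope.
Local Open Scope ring_scope.

(* Gives the concrete field [R[i]] the normed structure that MathComp-Analysis
   attaches to abstract closed fields. *)
#[non_forgetful_inheritance]
HB.instance Definition _ (R : realType) := GRing.ComAlgebra.copy R[i] R[i]^o.
#[non_forgetful_inheritance]
HB.instance Definition _ (R : realType) := Vector.copy R[i] R[i]^o.
#[non_forgetful_inheritance]
HB.instance Definition _ (R : realType) := NormedModule.copy R[i] R[i]^o.

(** * Complex numbers *)

Section ComplexModulus.
Context {R : realType}.
Local Notation C := R[i].
Implicit Types z w : C.

Definition cabs z : R := Normc.normc z.

Lemma normr_cabs z : `|z| = (cabs z)%:C%C. Proof. by []. Qed.

Lemma cabs_ge0 z : 0 <= cabs z.
Proof. by case: z => a b; exact: sqrtr_ge0. Qed.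

Lemma cabs0 : cabs 0 = 0. Proof. exact: Normc.normc0. Qed.
Lemma cabs1 : cabs 1 = 1. Proof. exact: Normc.normc1. Qed.

Lemma cabs_eq0 z : cabs z = 0 -> z = 0.
Proof. exact: Normc.eq0_normc. Qed.

Lemma cabsM z w : cabs (z * w) = cabs z * cabs w.
Proof. exact: Normc.normcM. Qed.

Lemma cabsV z : cabs z^-1 = (cabs z)^-1.
Proof. exact: Normc.normcV. Qed.

Lemma cabsD z w : cabs (z + w) <= cabs z + cabs w.
Proof. exact: le_normcD. Qed.

Lemma cabsN z : cabs (- z) = cabs z.
Proof. exact: normcN. Qed.

Lemma cabsB z w : cabs (z - w) <= cabs z + cabs w.
Proof. by rewrite -(cabsN w); exact: cabsD. Qed.

Lemma cabsC z w : cabs (z - w) = cabs (w - z).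
Proof. by rewrite -cabsN opprB. Qed.

Lemma cabs_tri u z w : cabs (z - w) <= cabs (z - u) + cabs (u - w).
Proof. by rewrite -(subrK u z) -addrA -[X in _ <= X + _]/(cabs _) addrK;
  exact: cabsD. Qed.

Lemma cabsX z n : cabs (z ^+ n) = cabs z ^+ n.
Proof. by elim: n => [|n IH]; rewrite ?expr0 ?cabs1 // !exprS cabsM IH. Qed.

Lemma cabs_sum (I : Type) (s : seq I) (P : pred I) (F : I -> C) :
  cabs (\sum_(i <- s | P i) F i) <= \sum_(i <- s | P i) cabs (F i).
Proof.
elim/big_rec2: _ => [|i y x _ le]; first by rewrite cabs0.
by apply: le_trans (cabsD _ _) _; rewrite lerD2l.
Qed.

Lemma cabs_prod (I : Type) (s : seq I) (P : pred I) (F : I -> C) :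
  cabs (\prod_(i <- s | P i) F i) = \prod_(i <- s | P i) cabs (F i).
Proof.
by elim/big_rec2: _ => [|i y x _ <-]; rewrite ?cabs1 ?cabsM.
Qed.

Lemma cabs_real (x : R) : cabs (x%:C)%C = `|x|.
Proof. by rewrite /cabs /= expr0n addr0 sqrtr_sqr. Qed.

Lemma cabs_nat n : cabs n%:R = n%:R.
Proof. by rewrite -(rmorph_nat (real_complex R)) cabs_real normr_nat. Qed.

Lemma Re_le_cabs z : `|complex.Re z| <= cabs z.
Proof.
case: z => a b /=; rewrite -sqrtr_sqr /cabs /= ler_wsqrtr //.
by rewrite lerDl sqr_ge0.
Qed.

Lemma Im_le_cabs z : `|complex.Im z| <= cabs z.
Proof.
case: z => a b /=; rewrite -sqrtr_sqr /cabs /= ler_wsqrtr //.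
by rewrite lerDr sqr_ge0.
Qed.

Lemma cabs_le_ReIm z : cabs z <= `|complex.Re z| + `|complex.Im z|.
Proof.
case: z => a b /=; rewrite -[leRHS]ger0_norm ?addr_ge0 // -sqrtr_sqr /cabs /=.
rewrite ler_wsqrtr // sqrrD !real_normK ?num_real //.
by rewrite lerD2r lerDl mulrn_wge0 // mulr_ge0.
Qed.

Definition ccvg (u : nat -> C) (l : C) :=
  forall e : R, 0 < e -> exists N, forall n, (N <= n)%N -> cabs (u n - l) <= e.

Lemma real_cauchy (u : nat -> R) :
  (forall e, 0 < e -> exists N, forall m n, (N <= m)%N -> (N <= n)%N ->
     `|u m - u n| <= e) ->
  exists l, forall e, 0 < e -> exists N, forall n, (N <= n)%N -> `|u n - l| <= e.
Proof.
move=> uC.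
have cu : cvg (u @ \oo).
  apply/cauchy_cvgP/cauchy_exP => e e0.
  have [N HN] := uC (e / 2) (divr_gt0 e0 (ltr0Sn _ 1)).
  exists (u N); exists N => // n /= Nn; rewrite /ball /=.
  by apply: le_lt_trans (HN _ _ (leqnn _) Nn) _; lra.
exists (lim (u @ \oo)) => e e0.
have /cvgrPdist_le /(_ e e0) [N _ HN] := cu.
by exists N => n Nn; rewrite distrC; exact: HN.
Qed.

Lemma ccvg_cauchy (u : nat -> C) :
  (forall e : R, 0 < e -> exists N, forall m n, (N <= m)%N -> (N <= n)%N ->
     cabs (u m - u n) <= e) ->
  exists l, ccvg u l.
Proof.
move=> uC.
have [|a Ha] := @real_cauchy (fun n => complex.Re (u n)).
  move=> e /uC [N HN]; exists N => m n Nm Nn.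
  by rewrite -raddfB; apply: le_trans (Re_le_cabs _) (HN _ _ Nm Nn).
have [|b Hb] := @real_cauchy (fun n => complex.Im (u n)).
  move=> e /uC [N HN]; exists N => m n Nm Nn.
  by rewrite -raddfB; apply: le_trans (Im_le_cabs _) (HN _ _ Nm Nn).
exists (Complex a b) => e e0.
have [N1 H1] := Ha (e / 2) (divr_gt0 e0 (ltr0Sn _ 1)).
have [N2 H2] := Hb (e / 2) (divr_gt0 e0 (ltr0Sn _ 1)).
exists (maxn N1 N2) => n; rewrite geq_max => /andP[/H1 h1 /H2 h2].
apply: le_trans (cabs_le_ReIm _) _; rewrite !raddfB /=; lra.
Qed.

Lemma ccvg_unique u l l' : ccvg u l -> ccvg u l' -> l = l'.
Proof.
move=> h h'; apply/eqP; rewrite -subr_eq0; apply/eqP/cabs_eq0/eqP.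
rewrite eq_le cabs_ge0 andbT; apply/ler_addgt0Pr => e e0; rewrite add0r.
have [N1 H1] := h (e / 2) (divr_gt0 e0 (ltr0Sn _ 1)).
have [N2 H2] := h' (e / 2) (divr_gt0 e0 (ltr0Sn _ 1)).
have h1 := H1 _ (leq_maxl N1 N2); have h2 := H2 _ (leq_maxr N1 N2).
rewrite cabsC in h1.
by apply: le_trans (cabs_tri (u (maxn N1 N2)) _ _) _; lra.
Qed.

Lemma ccvg_cst l : ccvg (fun=> l) l.
Proof. by move=> e e0; exists 0%N => n _; rewrite subrr cabs0 ltW. Qed.

Lemma ccvgD u v l l' : ccvg u l -> ccvg v l' -> ccvg (fun n => u n + v n) (l + l').
Proof.
move=> h h' e e0.
have [N1 H1] := h (e / 2) (divr_gt0 e0 (ltr0Sn _ 1)).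
have [N2 H2] := h' (e / 2) (divr_gt0 e0 (ltr0Sn _ 1)).
exists (maxn N1 N2) => n; rewrite geq_max => /andP[/H1 h1 /H2 h2].
by rewrite opprD addrACA; apply: le_trans (cabsD _ _) _; lra.
Qed.

Lemma ccvgZ (c : C) u l : ccvg u l -> ccvg (fun n => c * u n) (c * l).
Proof.
move=> h e e0; have c0 := cabs_ge0 c.
have [|N HN] := h (e / (cabs c + 1)); first by rewrite divr_gt0 //; lra.
exists N => n /HN hn; rewrite -mulrBr cabsM.
apply: (@le_trans _ _ ((cabs c + 1) * (e / (cabs c + 1)))).
  by apply: ler_pM => //; rewrite ?cabs_ge0 //; lra.
by rewrite mulrC divfK //; apply/eqP; lra.
Qed.

Lemma ccvgB u v l l' : ccvg u l -> ccvg v l' -> ccvg (fun n => u n - v n) (l - l').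
Proof.
move=> hu /(ccvgZ (-1)) hv; have := ccvgD _ _ _ _ hu hv.
by rewrite mulN1r; congr ccvg; apply/funext => n; rewrite mulN1r.
Qed.

Lemma ccvg_sum (I : Type) (s : seq I) (u : I -> nat -> C) (l : I -> C) :
  (forall i, ccvg (u i) (l i)) ->
  ccvg (fun n => \sum_(i <- s) u i n) (\sum_(i <- s) l i).
Proof.
move=> h; elim: s => [|i s IH].
  by rewrite big_nil; under eq_fun do rewrite big_nil; exact: ccvg_cst.
by rewrite big_cons; under eq_fun do rewrite big_cons; exact: ccvgD.
Qed.

Lemma ccvg_bound u l (M : R) : ccvg u l ->
  (exists N, forall n, (N <= n)%N -> cabs (u n) <= M) -> cabs l <= M.
Proof.
move=> h [N1 H1]; apply/ler_addgt0Pr => e /h [N2 H2].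
have := H1 _ (leq_maxl N1 N2); have := H2 _ (leq_maxr N1 N2).
rewrite cabsC => h1 h2; rewrite -(subrK (u (maxn N1 N2)) l).
by apply: le_trans (cabsD _ _) _; lra.
Qed.

End ComplexModulus.

Section ComplexExponential.
Context {R : realType}.
Local Notation C := R[i].

Lemma cexp0 : cexp 0 = 1 :> C.
Proof. by rewrite /cexp /= expR0 cos0 sin0 mulr1 mulr0. Qed.

Lemma cexpD (z w : C) : cexp (z + w) = cexp z * cexp w.
Proof.
case: z w => [a b] [c d]; rewrite /cexp /= expRD cosD sinD.
by apply/eqP; rewrite eq_complex /=; apply/andP; split; apply/eqP; ring.
Qed.

Lemma cabs_cexp (z : C) : cabs (cexp z) = expR (complex.Re z).
Proof.
case: z => a b; rewrite /cexp /cabs /= !exprMn -mulrDr cos2Dsin2 mulr1.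
by rewrite sqrtr_sqr ger0_norm ?expR_ge0.
Qed.

Lemma cexp_neq0 (z : C) : cexp z != 0.
Proof.
apply/eqP => z0; have := cabs_cexp z; rewrite z0 cabs0 => /esym/eqP.
by rewrite gt_eqF ?expR_gt0.
Qed.

Lemma cexpN (z : C) : cexp (- z) = (cexp z)^-1.
Proof.
by apply: (mulfI (cexp_neq0 z)); rewrite -cexpD subrr cexp0 divff ?cexp_neq0.
Qed.

Lemma cexpMn (z : C) n : cexp (z *+ n) = cexp z ^+ n.
Proof.
by elim: n => [|n IH]; rewrite ?mulr0n ?cexp0 // mulrS cexpD IH exprS.
Qed.

Lemma unit_expD (a b : R) : unit_exp (a + b) = unit_exp a * unit_exp b.
Proof.
rewrite /unit_exp -cexpD; congr cexp; apply/eqP.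
by rewrite eq_complex /= addr0 mulrDr !eqxx.
Qed.

Lemma unit_exp0 : unit_exp 0 = 1 :> C.
Proof. by rewrite /unit_exp mulr0 cexp0. Qed.

Lemma unit_exp_natr (a : R) n : unit_exp (a * n%:R) = unit_exp a ^+ n.
Proof.
elim: n => [|n IH]; first by rewrite mulr0 unit_exp0 expr0.
by rewrite -natr1 mulrDr mulr1 unit_expD IH exprSr.
Qed.

Lemma cabs_unit_exp (a : R) : cabs (unit_exp a) = 1.
Proof. by rewrite cabs_cexp expR0. Qed.

Lemma unit_exp_nat n : unit_exp n%:R = 1 :> C.
Proof.
rewrite -[n%:R]mul1r unit_exp_natr (_ : unit_exp 1 = 1) ?expr1n //.
rewrite /unit_exp /cexp /= expR0 !mul1r mulr1 mulr_natl.
by rewrite cos2pi sin2pi.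
Qed.

Lemma unit_exp_int (a : R) : a \is a Num.int -> unit_exp a = 1.
Proof.
move=> /intrP[[n|n] ->]; first exact: unit_exp_nat.
rewrite NegzE rmorphN /= -[LHS]mulr1 -{1}(unit_exp_nat n.+1) -unit_expD.
by rewrite -[_%:~R]/(n.+1%:R : R) addNr unit_exp0.
Qed.

(** For the fractional part [b] of [a], [cos (2 pi b) = 1] and the double-angle formula give
    [sin (pi b) = 0], whereas [sin (pi b) > 0] if [0 < b < 1]. *)
Lemma unit_exp_eq1 (a : R) : unit_exp a = 1 -> a \is a Num.int.
Proof.
move=> a1; have fa : (Num.floor a)%:~R \is a @Num.int R by exact: intr_int.
have [/andP[lo hi]] : (Num.floor a)%:~R <= a < (Num.floor a + 1)%:~R.
  by rewrite Num.Theory.floor_itv ?num_real.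
pose b := a - (Num.floor a)%:~R.
have b01 : 0 <= b < 1 by rewrite /b; rewrite intrD in hi; apply/andP; split; lra.
have: unit_exp b = 1.
  by rewrite /b unit_expD a1 unit_exp_int ?rpredN // mul1r.
rewrite /unit_exp /cexp /= expR0 !mul1r => -[c1 _].
have [b0|b0] := eqVneq b 0.
  by rewrite -[a](subrK (Num.floor a)%:~R) -/b b0 add0r.
have bgt0 : 0 < b by case/andP: b01 => ? _; rewrite lt_def b0.
have s0 : 0 < sin (pi * b).
  apply: sin_gt0_pi; rewrite mulr_gt0 ?pi_gt0 //=.
  by rewrite gtr_pMr ?pi_gt0 //; case/andP: b01.
have := cosD (pi * b) (pi * b); rewrite -mulrDr -mulr2n -mulr_natl.
rewrite (_ : pi * (2%:R * b) = 2 * pi * b); last by ring.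
rewrite c1; have := cos2Dsin2 (pi * b); nra.
Qed.

End ComplexExponential.

(** * Cauchy's estimate for polynomials in one variable *)

Section CauchyEstimate.
Context {R : realType}.
Local Notation C := R[i].

(** Orthogonality of the characters of [Z/n]: unless [n] divides [m], the geometric sum vanishes
    because [w ^+ n = 1] and [w != 1]. *)
Lemma sum_unit_exp_powers n m : (0 < n)%N ->
  \sum_(j < n) unit_exp (m%:R / n%:R : R) ^+ j = ((n %| m)%N * n)%:R.
Proof.
move=> n0; have nR0 : n%:R != 0 :> R by rewrite pnatr_eq0 -lt0n.
set w := unit_exp _.
have wn : w ^+ n = 1 by rewrite -unit_exp_natr divfK // unit_exp_nat.
have [/dvdnP[k mk]|nm] := boolP (n %| m)%N.
  have -> : w = 1 by rewrite /w mk natrM mulfK // unit_exp_nat.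
  by rewrite mul1n; under eq_bigr do rewrite expr1n; rewrite sumr_const card_ord.
rewrite mul0n; have w1 : w - 1 != 0.
  rewrite subr_eq0; apply/eqP => /unit_exp_eq1.
  rewrite intrEge0 ?divr_ge0 ?ler0n // => /natrP[k /(congr1 ( *%R^~ n%:R))].
  rewrite divfK // -natrM => /eqP; rewrite eqr_nat => /eqP mk.
  by move: nm; rewrite mk dvdn_mull.
by apply: (mulfI w1); rewrite -subrX1 wn subrr mulr0.
Qed.

(** A discrete Cauchy integral: the average of [p.[z] * z ^+ (n - k)] over the [n]-th roots of unity
    is exactly the [k]-th coefficient. Since [n > size p + k], no other coefficient has an index
    congruent to [k] modulo [n]. *)
Lemma cauchy_estimate (p : {poly C}) (M : R) k :
  (forall z, cabs z <= 1 -> cabs p.[z] <= M) -> cabs p`_k <= M.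
Proof.
move=> pM; pose n := (size p + k).+1.
have n0 : (0 < n)%N by [].
have nR0 : n%:R != 0 :> R by rewrite pnatr_eq0.
pose w := unit_exp (n%:R^-1 : R).
have key : \sum_(j < n) p.[w ^+ j] * (w ^+ j) ^+ (n - k) = n%:R * p`_k.
  under eq_bigr do rewrite horner_coef mulr_suml.
  rewrite exchange_big /=.
  transitivity (\sum_(i < size p) p`_i * ((n %| i + (n - k))%N * n)%:R).
    apply: eq_bigr => i _; rewrite -sum_unit_exp_powers // [_ / _]mulrC
      unit_exp_natr mulr_sumr.
    by apply: eq_bigr => j _; rewrite -mulrA -exprD -!exprM mulnC.
  have kn : (k <= n)%N by rewrite /n ltnW // ltnS leq_addl.
  have dvdE (i : 'I_(size p)) : (n %| i + (n - k))%N = (i == k :> nat).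
    apply/idP/eqP => [|->]; last by rewrite subnKC.
    move=> /dvdnP[q]; have := ltn_ord i; rewrite /n => ip.
    case: q => [|[|q]]; nia.
  under eq_bigr do rewrite dvdE.
  have [kp|kp] := ltnP k (size p).
    rewrite (bigD1 (Ordinal kp)) //= eqxx mul1n mulrC big1 ?addr0 // => i ik.
    by rewrite (_ : _ == _ = false) ?mulr0 //; exact/negbTE.
  rewrite (nth_default _ kp) mulr0 big1 // => i _.
  rewrite (_ : _ == _ = false) ?mulr0 //; apply/negbTE.
  by rewrite neq_ltn (leq_trans (ltn_ord i) kp).
have : cabs (n%:R * p`_k) <= n%:R * M.
  rewrite -key; apply: le_trans (cabs_sum _ _ _ _) _.
  apply: (@le_trans _ _ (\sum_(j < n) M)).
    apply: ler_sum => j _; rewrite cabsM !cabsX cabs_unit_exp !expr1n mulr1.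
    by apply: pM; rewrite cabsX cabs_unit_exp expr1n.
  by rewrite sumr_const card_ord mulr_natl.
by rewrite cabsM cabs_nat ler_pM2l // ltr0n.
Qed.

End CauchyEstimate.

Lemma differentiable_epsilon (K : numFieldType) (V W : normedModType K)
    (f : V -> W) (df : {linear V -> W}) (t : V) :
  continuous df ->
  (forall e : K, 0 < e ->
     \forall h \near (0 : V), `|f (t + h) - f t - df h| <= e * `|h|) ->
  differentiable f t.
Proof.
move=> dfc fe.
have key : f \o shift t = cst (f t) + df +o_ 0 id.
  apply/eqaddoP => e e0; near=> h.
  rewrite [X in `|X|](_ : _ = f (t + h) - f t - df h).
    by near: h; exact: fe.
  by rewrite !fctE /= opprD addrA [h + t]addrC.
by apply/diff_locallyP; rewrite (diff_unique dfc key).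
Unshelve. all: by end_near. Qed.

(** * Uniform limits of polynomials *)

Section L1Balls.
Context {R : realType} {r : nat}.
Local Notation C := R[i].
Implicit Types (s t h : 'rV[C]_r).

(** The norm of ['rV[C]_r] takes its values in [C]; this equivalent norm is real-valued, and adding
    two coordinates into one does not increase it. *)
Definition norm1 h : R := \sum_(l < r) cabs (h 0 l).

Lemma norm1_ge0 h : 0 <= norm1 h.
Proof. by apply: sumr_ge0 => l _; exact: cabs_ge0. Qed.

Lemma norm1_0 : norm1 0 = 0.
Proof. by apply: big1 => l _; rewrite mxE cabs0. Qed.

Lemma norm1_eq0 h : norm1 h = 0 -> h = 0.
Proof.
move=> h0; apply/rowP => l; rewrite mxE; apply: cabs_eq0; apply/eqP.
rewrite eq_le cabs_ge0 andbT -h0 /norm1 (bigD1 l) //= lerDl.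
by apply: sumr_ge0 => *; exact: cabs_ge0.
Qed.

Lemma cabs_le_norm1 h l : cabs (h 0 l) <= norm1 h.
Proof.
rewrite /norm1 (bigD1 l) //= lerDl.
by apply: sumr_ge0 => *; exact: cabs_ge0.
Qed.

Lemma norm1D h k : norm1 (h + k) <= norm1 h + norm1 k.
Proof.
by rewrite -big_split /=; apply: ler_sum => l _; rewrite mxE; exact: cabsD.
Qed.

Lemma norm1Z (c : C) h : norm1 (c *: h) = cabs c * norm1 h.
Proof. by rewrite mulr_sumr; apply: eq_bigr => l _; rewrite mxE cabsM. Qed.

Lemma norm1N h : norm1 (- h) = norm1 h.
Proof. by apply: eq_bigr => l _; rewrite mxE cabsN. Qed.

Lemma cabs_le_normr h l : (cabs (h 0 l))%:C%C <= `|h|.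
Proof.
rewrite -normr_cabs [leRHS]/Num.norm /= mx_normE -[leLHS]nngE num_le.
by have := @le_bigmax _ _ _ (0%:nng)%R
  (fun ij : 'I_1 * 'I_r => `|h ij.1 ij.2|%:nng) (0, l).
Qed.

Lemma norm1_le_normr h : (norm1 h)%:C%C <= r%:R * `|h|.
Proof.
rewrite /norm1 rmorph_sum /= mulr_natl.
apply: (@le_trans _ _ (\sum_(l < r) `|h|)); last by rewrite sumr_const card_ord.
by apply: ler_sum => l _; exact: cabs_le_normr.
Qed.

Lemma near_norm1P s (P : set 'rV[C]_r) :
  (\forall t \near s, P t) <->
  exists2 d : R, 0 < d & forall t, norm1 (t - s) < d -> P t.
Proof.
split => [/nbhs_ballP[e /= e0 sP]|[d d0 dP]].
  have eR : e = (complex.Re e)%:C%C by rewrite RRe_real // gtr0_real.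
  have e0' : 0 < complex.Re e by rewrite eR ltcR in e0.
  exists (complex.Re e) => // t ts; apply: sP; split => // i l.
  rewrite (ord1 i) /ball /= normr_cabs eR ltcR cabsC.
  apply: le_lt_trans _ ts; apply: le_trans _ (cabs_le_norm1 _ l).
  by rewrite !mxE.
(* Dividing by [r.+1] keeps the last inequality strict and covers [r = 0]. *)
apply/nbhs_ballP; exists (d / r.+1%:R)%:C%C => /=.
  by rewrite ltcR divr_gt0.
move=> t [_ st]; apply: dP.
apply: (@le_lt_trans _ _ (\sum_(l < r) d / r.+1%:R)).
  apply: ler_sum => l _; rewrite !mxE -lecR -normr_cabs distrC ltW //.
  exact: st.
rewrite sumr_const card_ord -[_ *+ r]mulr_natr -mulrA gtr_pMr //.
by rewrite mulrC ltr_pdivrMr ?ltr0Sn // mul1r ltr_nat.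
Qed.

Lemma differentiable_quadratic (f : 'rV[C]_r -> C^o) t (d : 'I_r -> C) (M e : R) :
  0 < e ->
  (forall h, norm1 h < e ->
    cabs (f (t + h) - f t - \sum_(l < r) h 0 l * d l) <= M * norm1 h ^+ 2) ->
  differentiable f t.
Proof.
move=> e0 fM.
pose D (h : 'rV[C]_r) : C^o := \sum_(l < r) h 0 l * d l.
have D_lin : linear D.
  move=> c u v; rewrite /D scaler_sumr -big_split; apply: eq_bigr => l _ /=.
  by rewrite !mxE mulrDl -mulrA.
pose DlM := GRing.isLinear.Build _ _ _ _ _ D_lin.
pose DL : {linear 'rV[C]_r -> C^o} := HB.pack D DlM.
have Dc : continuous DL.
  move=> x; apply: differentiable_continuous.
  have -> : (DL : 'rV[C]_r -> C^o) =
      \sum_(l < r) ((fun v : 'rV[C]_r => v 0 l : C^o) * cst (d l : C^o)).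
    by apply/funext => v; rewrite fct_sumE; apply: eq_bigr.
  apply: differentiable_sum => l; apply: differentiableM => //.
  exact: differentiable_coord.
apply: (differentiable_epsilon _ _ _ f DL) => // eps eps0.
have epsR : eps = (complex.Re eps)%:C%C by rewrite RRe_real // gtr0_real.
set ep := complex.Re _ in epsR.
have ep0 : 0 < ep by rewrite epsR ltcR in eps0.
have M0 : 0 < `|M| * r%:R + 1 by rewrite ltr_pwDr // mulr_ge0.
(* The remainder is at most [|M| * norm1 h] times [r * |h|], so this radius makes it at most
   [eps * |h|]. *)
apply/near_norm1P; exists (Num.min e (ep / (`|M| * r%:R + 1))).
  by rewrite lt_min e0 divr_gt0.
move=> h; rewrite subr0 lt_min => /andP[he hep].
have n0 := norm1_ge0 h.
rewrite -[X in X <= _]/(`|(f (t + h) - f t - D h : C)|) normr_cabs.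
apply: (@le_trans _ _ (M * norm1 h ^+ 2)%:C%C).
  by rewrite lecR; exact: fM.
apply: (@le_trans _ _ ((`|M| * norm1 h)%:C%C * (r%:R * `|h|))).
  apply: (@le_trans _ _ ((`|M| * norm1 h)%:C%C * (norm1 h)%:C%C)).
    rewrite -rmorphM lecR expr2 mulrA; apply: ler_wpM2r => //.
    by apply: ler_wpM2r => //; exact: ler_norm.
  apply: ler_wpM2l; last exact: norm1_le_normr.
  by rewrite (_ : 0 = 0%:C%C) // lecR mulr_ge0.
rewrite mulrA; apply: ler_wpM2r => //.
rewrite epsR -(rmorph_nat (real_complex R)) -rmorphM lecR.
move: hep; rewrite ltr_pdivlMr // => /ltW; nra.
Qed.

End L1Balls.

Section PolynomialFunctions.
Context {R : realType} {r : nat}.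
Local Notation C := R[i].
Implicit Types (s t h : 'rV[C]_r) (f g : 'rV[C]_r -> C).

Inductive polyfun : ('rV[C]_r -> C) -> Prop :=
| polyfun_cst c : polyfun (fun=> c)
| polyfun_coord l : polyfun (fun t => t 0 l)
| polyfunD f g : polyfun f -> polyfun g -> polyfun (fun t => f t + g t)
| polyfunM f g : polyfun f -> polyfun g -> polyfun (fun t => f t * g t).

(** Reduces estimates in several variables to [cauchy_estimate] on complex lines. The gradient [d]
    is chosen before the direction [h], so that one linear form serves all lines through [t]. *)
Lemma polyfun_line f : polyfun f -> forall t, exists d : 'I_r -> C,
  forall h, exists p : {poly C}, (forall z, f (t + z *: h) = p.[z]) /\
    p`_1 = \sum_(l < r) h 0 l * d l.
Proof.
elim=> [c|l|{}f g _ IHf _ IHg|{}f g _ IHf _ IHg] t.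
- exists (fun=> 0) => h; exists c%:P; split => [z|]; first by rewrite hornerC.
  by rewrite coefC big1 // => l _; rewrite mulr0.
- exists (fun l' => (l' == l)%:R) => h; exists ((t 0 l)%:P + h 0 l *: 'X).
  split => [z|]; first by rewrite !mxE !hornerE mulrC.
  rewrite coefD coefC coefZ coefX /= add0r mulr1 (bigD1 l) //= eqxx mulr1.
  by rewrite big1 ?addr0 // => i /negbTE ->; rewrite mulr0.
- have [df Hf] := IHf t; have [dg Hg] := IHg t.
  exists (fun l => df l + dg l) => h.
  have [p [ep p1]] := Hf h; have [q [eq q1]] := Hg h.
  exists (p + q); split => [z|]; first by rewrite hornerD ep eq.
  by rewrite coefD p1 q1 -big_split; apply: eq_bigr => l _; rewrite mulrDr.
- have [df Hf] := IHf t; have [dg Hg] := IHg t.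
  exists (fun l => f t * dg l + df l * g t) => h.
  have [p [ep p1]] := Hf h; have [q [eq q1]] := Hg h.
  exists (p * q); split => [z|]; first by rewrite hornerM ep eq.
  have p0 : p`_0 = f t by rewrite -horner_coef0 -ep scale0r addr0.
  have q0 : q`_0 = g t by rewrite -horner_coef0 -eq scale0r addr0.
  rewrite coefM big_ord_recl big_ord1 /= p0 p1 q0 q1.
  rewrite mulr_sumr mulr_suml -big_split; apply: eq_bigr => l _ /=; ring.
Qed.

Lemma polyfun_bounded f : polyfun f -> forall s (rho : R), exists M : R,
  forall t, norm1 (t - s) <= rho -> cabs (f t) <= M.
Proof.
elim=> [c|l|{}f g _ IHf _ IHg|{}f g _ IHf _ IHg] s rho.
- by exists (cabs c).
- exists (cabs (s 0 l) + rho) => t ts.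
  rewrite -(subrKC (s 0 l) (t 0 l)); apply: le_trans (cabsD _ _) _.
  rewrite lerD2l; apply: le_trans _ ts; apply: le_trans _ (cabs_le_norm1 _ l).
  by rewrite !mxE.
- have [M HM] := IHf s rho; have [N HN] := IHg s rho.
  exists (M + N) => t ts; apply: le_trans (cabsD _ _) _.
  by rewrite lerD ?HM ?HN.
- have [M HM] := IHf s rho; have [N HN] := IHg s rho.
  by exists (M * N) => t ts; rewrite cabsM ler_pM ?cabs_ge0 ?HM ?HN.
Qed.

(** Cauchy's estimate along the [l]-th coordinate direction. Assuming the expansion on lines for a
    given [d] makes the lemma applicable to a difference of two functions with the difference of
    their gradients. *)
Lemma polyfun_linear_coef f t (d : 'I_r -> C) (M e : R) :
  (forall h, exists p : {poly C}, (forall z, f (t + z *: h) = p.[z]) /\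
    p`_1 = \sum_(l < r) h 0 l * d l) ->
  0 < e -> (forall h, norm1 h <= e -> cabs (f (t + h)) <= M) ->
  forall l, cabs (d l) * e <= M.
Proof.
move=> Hd e0 fM l.
pose h : 'rV[C]_r := (e%:C)%C *: \row_j (j == l)%:R.
have [p [ep p1]] := Hd h.
have -> : cabs (d l) * e = cabs p`_1.
  rewrite p1 (bigD1 l) //= big1 => [|i /negbTE il].
    by rewrite addr0 !mxE eqxx mulr1 cabsM cabs_real mulrC gtr0_norm.
  by rewrite !mxE il mulr0 mul0r.
apply: cauchy_estimate => z z1; rewrite -ep; apply: fM.
rewrite !norm1Z cabs_real gtr0_norm // [norm1 _](_ : _ = 1).
  by rewrite mulr1 ger_pMl.
rewrite /norm1 (bigD1 l) //= !mxE eqxx cabs1 big1 ?addr0 // => i /negbTE il.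
by rewrite !mxE il cabs0.
Qed.

(** On the line along [h], rescaled to radius [e], [f (t + h) = p.[x]] with
    [x = norm1 h / e <= 1/2], and Cauchy's estimate bounds every coefficient of [p] by [M]. The
    terms of degree at least two are then dominated by a geometric series with sum at most
    [2 M x^2]. *)
Lemma polyfun_quadratic f t (d : 'I_r -> C) (M e : R) :
  (forall h, exists p : {poly C}, (forall z, f (t + z *: h) = p.[z]) /\
    p`_1 = \sum_(l < r) h 0 l * d l) ->
  0 < e -> (forall h, norm1 h <= e -> cabs (f (t + h)) <= M) ->
  forall h, norm1 h <= e / 2 ->
  cabs (f (t + h) - f t - \sum_(l < r) h 0 l * d l)
    <= 2 * M / e ^+ 2 * norm1 h ^+ 2.
Proof.
move=> Hd e0 fM h he.
have M0 : 0 <= M by apply: le_trans (cabs_ge0 _) (fM 0 _); rewrite norm1_0 ltW.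
have [/norm1_eq0 ->|hn0] := eqVneq (norm1 h) 0.
  rewrite addr0 subrr sub0r big1 ?oppr0 ?cabs0 ?norm1_0 ?expr0n ?mulr0 //.
  by move=> l _; rewrite mxE mul0r.
have h0 : 0 < norm1 h by rewrite lt_def hn0 norm1_ge0.
pose x := norm1 h / e.
have x0 : 0 < x by rewrite divr_gt0.
have x2 : x <= 1 / 2 by rewrite ler_pdivrMr //; lra.
have [p [ep p1]] := Hd ((x^-1)%:C%C *: h).
have pM k : cabs p`_k <= M.
  apply: cauchy_estimate => z z1; rewrite -ep; apply: fM.
  rewrite !norm1Z cabs_real gtr0_norm ?invr_gt0 //.
  by rewrite [_ * norm1 h](_ : _ = e) ?ger_pMl // /x invf_div divfK.
have xC : (x%:C)%C != 0 by rewrite eq_complex /= negb_and gt_eqF.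
have th : f (t + h) = p.[(x%:C)%C].
  by rewrite -ep scalerA -rmorphM mulfV ?gt_eqF // scale1r.
have t0 : f t = p`_0 by rewrite -horner_coef0 -ep scale0r addr0.
have dh : \sum_(l < r) h 0 l * d l = (x%:C)%C * p`_1.
  rewrite p1 mulr_sumr; apply: eq_bigr => l _; rewrite !mxE !mulrA -rmorphM.
  by rewrite mulfV ?gt_eqF // mul1r.
have -> : f (t + h) - f t - \sum_(l < r) h 0 l * d l =
    \sum_(k < size p) p`_(k.+2) * (x%:C)%C ^+ k.+2.
  rewrite th t0 dh (@horner_coef_wide _ (size p).+2); last by rewrite -addn2 leq_addr.
  rewrite !big_ord_recl /= expr0 mulr1 expr1 [p`_1 * _]mulrC.
  by rewrite (_ : forall a b c : C, a + (b + c) - a - b = c) // => a b c; ring.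
apply: le_trans (cabs_sum _ _ _ _) _.
apply: (@le_trans _ _ (\sum_(k < size p) M * x ^+ 2 * 2^-1 ^+ k)).
  apply: ler_sum => k _; rewrite cabsM cabsX cabs_real gtr0_norm // -addn2 exprD.
  rewrite -mulrA; apply: ler_pM; rewrite ?cabs_ge0 ?pM //.
    by rewrite mulr_ge0 // exprn_ge0 // ltW.
  rewrite mulrC; apply: ler_wpM2l; first by rewrite exprn_ge0 // ltW.
  by apply: lerXn2r; rewrite ?nnegrE ?invr_ge0 ?(ltW x0) // -[2^-1]mul1r.
rewrite -mulr_sumr.
have -> : 2 * M / e ^+ 2 * norm1 h ^+ 2 = M * x ^+ 2 * 2.
  by rewrite /x expr_div_n; ring.
apply: ler_wpM2l; first by rewrite mulr_ge0 ?exprn_ge0 ?(ltW x0).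
have := subrX1 (2^-1 : R) (size p).
have : 0 <= (2^-1 : R) ^+ size p by rewrite exprn_ge0.
set S := \sum_(_ < _) _; lra.
Qed.

End PolynomialFunctions.

(** * Taylor estimates *)

Section RealVariable.
Context {R : realType}.
Local Notation C := R[i].
Implicit Types (f g : R -> C) (x : R).

Definition cderiv f x (d : C) :=
  is_derive x 1 (fun y => complex.Re (f y)) (complex.Re d) /\
  is_derive x 1 (fun y => complex.Im (f y)) (complex.Im d).

Lemma cderiv_cst (c : C) x : cderiv (fun=> c) x 0.
Proof. by split; exact: is_derive_cst. Qed.

Lemma cderivD f g x df dg : cderiv f x df -> cderiv g x dg ->
  cderiv (fun y => f y + g y) x (df + dg).
Proof.
move=> [f1 f2] [g1 g2]; split.
  under eq_fun do rewrite raddfD; rewrite raddfD; exact: is_deriveD.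
by under eq_fun do rewrite raddfD; rewrite raddfD; exact: is_deriveD.
Qed.

Lemma cderivZ (c : C) f x df : cderiv f x df -> cderiv (fun y => c * f y) x (c * df).
Proof.
case: c => a b [f1 f2].
have e (z : C) : Complex a b * z =
  Complex (a * complex.Re z - b * complex.Im z) (a * complex.Im z + b * complex.Re z).
  by case: z.
split; under eq_fun do rewrite e; rewrite e /=.
  by apply: is_deriveB; exact: is_deriveZ.
by apply: is_deriveD; exact: is_deriveZ.
Qed.

Lemma cderivB f g x df dg : cderiv f x df -> cderiv g x dg ->
  cderiv (fun y => f y - g y) x (df - dg).
Proof.
move=> hf /(cderivZ (-1)) hg; have := cderivD _ _ _ _ _ hf hg.
by rewrite mulN1r; congr cderiv; apply/funext => y; rewrite mulN1r.
Qed.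

Lemma cderiv_sum n (f : 'I_n -> R -> C) x (d : 'I_n -> C) :
  (forall i, cderiv (f i) x (d i)) ->
  cderiv (fun y => \sum_(i < n) f i y) x (\sum_(i < n) d i).
Proof.
elim: n f d => [|n IH] f d h.
  by rewrite big_ord0; under eq_fun do rewrite big_ord0; exact: cderiv_cst.
rewrite big_ord_recl; under eq_fun do rewrite big_ord_recl.
by apply: cderivD => //; apply: IH => i; exact: h.
Qed.

Lemma cderiv_real (f : R -> R) x d :
  is_derive x 1 f d -> cderiv (fun y => (f y)%:C%C) x (d%:C%C).
Proof. by move=> h; split => //=; exact: is_derive_cst. Qed.

Lemma cderiv_cexp (w : C) (f : R -> R) x d : is_derive x 1 f d ->
  cderiv (fun y => cexp (w * (f y)%:C%C)) x (w * d%:C%C * cexp (w * (f x)%:C%C)).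
Proof.
case: w => a b fd.
have e y : cexp (Complex a b * (f y)%:C%C) =
    Complex (expR (a * f y) * cos (b * f y)) (expR (a * f y) * sin (b * f y)).
  by rewrite /cexp /= !mulr0 subr0 add0r.
split; under eq_fun do rewrite e; rewrite e /= !mulr0 subr0 add0r.
- have -> : (fun y => expR (a * f y) * cos (b * f y)) =
    (expR \o (a *: f)) * (cos \o (b *: f)) by [].
  apply: is_derive_eq; rewrite /= /GRing.scale /=; ring.
- have -> : (fun y => expR (a * f y) * sin (b * f y)) =
    (expR \o (a *: f)) * (sin \o (b *: f)) by [].
  apply: is_derive_eq; rewrite /= /GRing.scale /=; ring.
Qed.

(** The factor 2 pays for applying the mean value theorem to the real and imaginary parts
    separately. *)
Lemma mean_value_cabs f f' (K b : R) : 0 <= b ->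
  (forall x, 0 <= x <= b -> cderiv f x (f' x)) ->
  (forall x, 0 <= x <= b -> cabs (f' x) <= K) ->
  cabs (f b - f 0) <= 2 * K * b.
Proof.
move=> b0 fd fK.
have part (h h' : R -> R) :
    (forall x, 0 <= x <= b -> is_derive x 1 h (h' x)) ->
    (forall x, 0 <= x <= b -> `|h' x| <= K) -> `|h b - h 0| <= K * b.
  move=> hd hK.
  have [||c cb ->] := @MVT_segment R h h' 0 b b0.
  - by move=> x; rewrite in_itv /= => /andP[x0 xb]; apply: hd; rewrite !ltW.
  - apply: derivable_within_continuous => x; rewrite in_itv /= => xb.
    by have [] := hd x xb.
  - rewrite subr0 normrM (ger0_norm b0) ler_wpM2r //; apply: hK.
    by rewrite in_itv in cb.
apply: le_trans (cabs_le_ReIm _) _; rewrite !raddfB /=.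
have h1 := part _ _ (fun x xb => (fd x xb).1)
  (fun x xb => le_trans (Re_le_cabs _) (fK x xb)).
have h2 := part _ _ (fun x xb => (fd x xb).2)
  (fun x xb => le_trans (Im_le_cabs _) (fK x xb)).
by rewrite /= in h1 h2; lra.
Qed.

(** The mean value bound is applied twice: to [cexp (z x)], then to [cexp (z x) - z x], whose
    derivative the first application controls. Each application costs a factor 2. *)
Lemma cexp_near1 (z : C) : cabs z <= 1 ->
  cabs (cexp z - 1 - z) <= 4 * expR 1 * cabs z ^+ 2.
Proof.
move=> z1; have z0 := cabs_ge0 z; have e0 : 0 < expR 1 :> R := expR_gt0 1.
have idd x : is_derive x 1 (id : R -> R) 1 by exact: is_derive_id.
have d0 x : cderiv (fun y => cexp (z * y%:C%C)) x (z * cexp (z * x%:C%C)).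
  by have := cderiv_cexp z _ _ _ (idd x); rewrite mulr1.
have b0 x : 0 <= x <= 1 -> cabs (cexp (z * x%:C%C)) <= expR 1.
  move=> /andP[x0 x1]; rewrite cabs_cexp.
  rewrite ler_expR; apply: le_trans (ler_norm _) _; apply: le_trans (Re_le_cabs _) _.
  by rewrite cabsM cabs_real ger0_norm // mulr_ile1.
have b1 x : 0 <= x <= 1 -> cabs (cexp (z * x%:C%C) - 1) <= 2 * expR 1 * cabs z.
  move=> /andP[x0 x1].
  have := mean_value_cabs (fun y => cexp (z * y%:C%C)) (fun y => z * cexp (z *
    y%:C%C))
    (expR 1 * cabs z) x x0.
  rewrite mulr0 cexp0 => h; apply: le_trans (h _ _) _ => //.
  - move=> y /andP[y0 yx]; rewrite cabsM mulrC ler_wpM2r // b0 // y0 /=.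
    exact: le_trans yx x1.
  - by have := mulr_ge0 (ltW e0) z0; nra.
have := mean_value_cabs (fun y => cexp (z * y%:C%C) - z * y%:C%C)
  (fun y => z * cexp (z * y%:C%C) - z) (2 * expR 1 * cabs z ^+ 2) 1 ler01.
rewrite !mulr0 cexp0 subr0 !mulr1 => h.
rewrite addrAC; apply: le_trans (h _ _) _.
- move=> x _; apply: cderivB; first exact: d0.
  by rewrite -[X in cderiv _ _ X]mulr1; apply: cderivZ; exact: cderiv_real.
- move=> x x01; rewrite -[X in _ - X]mulr1 -mulrBr cabsM.
  apply: le_trans (ler_wpM2l z0 (b1 x x01)) _.
  by rewrite le_eqVlt; apply/orP; left; apply/eqP; ring.
- by rewrite le_eqVlt; apply/orP; left; apply/eqP; ring.
Qed.

Lemma subrXX_le (a b : C) (M : R) n : cabs a <= M -> cabs b <= M ->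
  cabs (a ^+ n - b ^+ n) <= n%:R * M ^+ n.-1 * cabs (a - b).
Proof.
move=> aM bM; rewrite subrXX cabsM [leLHS]mulrC; apply: ler_wpM2r.
  exact: cabs_ge0.
apply: le_trans (cabs_sum _ _ _ _) _.
apply: (@le_trans _ _ (\sum_(i < n) M ^+ n.-1)).
  apply: ler_sum => i _; rewrite cabsM !cabsX.
  apply: (@le_trans _ _ (M ^+ (n.-1 - i) * M ^+ i)).
    by rewrite ler_pM ?exprn_ge0 ?cabs_ge0 // lerXn2r ?nnegrE ?cabs_ge0 //;
      apply: le_trans (cabs_ge0 a) aM.
  by rewrite -exprD subnK //; have := ltn_ord i; lia.
by rewrite sumr_const card_ord mulr_natl.
Qed.

(** Writes [cexp z] as a power of [cexp (z / (n + 1))] and compares the bases by [cexp_near1]. The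
    explicit rate makes [cexp] a limit of polynomials, uniformly on bounded sets. *)
Lemma cexp_euler (z : C) n : cabs z <= n.+1%:R ->
  cabs (cexp z - (1 + z / n.+1%:R) ^+ n.+1) <=
    4 * expR 1 * cabs z ^+ 2 * expR (cabs z) / n.+1%:R.
Proof.
set N := n.+1%:R => zN; have N0 : 0 < N by rewrite ltr0Sn.
have Nn0 : (n.+1%:R : C) != 0 by rewrite pnatr_eq0.
pose w := z / n.+1%:R; have wE : cabs w = cabs z / N by rewrite cabsM cabsV cabs_nat.
have w1 : cabs w <= 1 by rewrite wE ler_pdivrMr // mul1r.
have -> : cexp z = cexp w ^+ n.+1 by rewrite -cexpMn -mulr_natr divfK.
have M1 : cabs (cexp w) <= expR (cabs w).
  by rewrite cabs_cexp ler_expR; apply: le_trans (ler_norm _) (Re_le_cabs _).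
have M2 : cabs (1 + w) <= expR (cabs w).
  by apply: le_trans (cabsD _ _) _; rewrite cabs1 expR_ge1Dx.
apply: le_trans (subrXX_le _ _ _ n.+1 M1 M2) _ => /=.
have h := cexp_near1 _ w1; rewrite opprD addrA.
apply: (@le_trans _ _ (N * expR (cabs z) * (4 * expR 1 * cabs w ^+ 2))).
  apply: ler_pM => //; rewrite ?cabs_ge0 ?mulr_ge0 ?exprn_ge0 ?expR_ge0 ?ler0n //.
  rewrite ler_pM2l // -expRM_natl ler_expR wE mulrA ler_pdivrMr //.
  by rewrite mulrC ler_wpM2l ?cabs_ge0 // ler_nat.
by rewrite wE le_eqVlt; apply/orP; left; apply/eqP; field; rewrite gt_eqF.
Qed.

(** The falling factorial of [- w]: the [p]-th derivative of [x ^ (- w)] is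
    [fallc w p * x ^ (- w - p)]. *)
Definition fallc (w : C) p := \prod_(i < p) - (w + i%:R).

Lemma fallc0 w : fallc w 0 = 1. Proof. exact: big_ord0. Qed.

Lemma fallcS w p : fallc w p.+1 = - w * fallc (w + 1) p.
Proof.
rewrite /fallc big_ord_recl /= addr0; congr (_ * _); apply: eq_bigr => i _.
by rewrite /bump /= natrD addrA.
Qed.

(** Binomial expansion of [(1 + t u) ^ (- w)], uniform for [cabs w <= B]. The remainder of order
    [m + 1] for [w] vanishes at [t = 0], and its [t]-derivative is [- w u] times the remainder of
    order [m] for [w + 1]; so the mean value bound gives the induction. The variable [t] is there to
    be differentiated; the result is used at [t = 1]. *)
Lemma binomial_remainder (m : nat) (u B : R) (w : C) : `|u| <= 1 / 2 -> cabs w <= B ->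
  forall t, 0 <= t <= 1 ->
  cabs (cexp (- w * (ln (1 + t * u))%:C%C)
        - \sum_(p < m) fallc w p / p`!%:R * (t * u)%:C%C ^+ p)
  <= (2 * (B + m%:R)) ^+ m * expR ((B + m%:R) * ln 2) * (t * `|u|) ^+ m.
Proof.
move=> u2; have tu1 x : 0 <= x <= 1 -> `|x * u| <= 1 / 2.
  move=> /andP[x0 x1]; rewrite normrM ger0_norm //.
  by apply: le_trans _ u2; rewrite ler_piMl.
have tu2 x : 0 <= x <= 1 -> 1 / 2 <= 1 + x * u <= 3 / 2.
  by move=> /tu1; rewrite ler_norml => /andP[? ?]; apply/andP; split; lra.
elim: m w B => [|m IH] w B wB t t01.
  rewrite big_ord0 subr0 !expr0 mul1r mulr1 addr0 cabs_cexp ler_expR.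
  apply: le_trans (ler_norm _) _; apply: le_trans (Re_le_cabs _) _.
  rewrite cabsM cabsN cabs_real; apply: ler_pM => //; first exact: cabs_ge0.
  have /andP[lo hi] := tu2 t t01; rewrite ler_norml; apply/andP; split.
    by rewrite -lnV ?posrE // ler_ln ?posrE ?invr_gt0 //; lra.
  by rewrite ler_ln ?posrE //; lra.
have B0 : 0 <= B by apply: le_trans (cabs_ge0 w) wB.
have w1B : cabs (w + 1) <= B + 1 by apply: le_trans (cabsD _ _) _;
  rewrite cabs1 lerD2r.
have {IH} := IH _ _ w1B.
set K := _ * expR _ => IH.
pose g (x : R) := cexp (- (w + 1) * (ln (1 + x * u))%:C%C)
  - \sum_(p < m) fallc (w + 1) p / p`!%:R * (x * u)%:C%C ^+ p.
pose f (x : R) := cexp (- w * (ln (1 + x * u))%:C%C)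
  - \sum_(p < m.+1) fallc w p / p`!%:R * (x * u)%:C%C ^+ p.
have f0 : f 0 = 0.
  rewrite /f !mul0r addr0 ln1 mulr0 cexp0 big_ord_recl fallc0 divr1 expr0 mulr1.
  by rewrite big1 ?addr0 ?subrr // => i _; rewrite exprS mul0r mulr0.
have [t0 t1] : 0 <= t /\ t <= 1 by apply/andP.
have K0 : 0 <= K.
  by rewrite mulr_ge0 ?expR_ge0 // exprn_ge0 // mulr_ge0 // !addr_ge0.
have fd x : 0 <= x <= t -> cderiv f x (- w * u%:C%C * g x).
  move=> /andP[x0 xt]; have x01 : 0 <= x <= 1 by rewrite x0 (le_trans xt).
  have /andP[lo hi] := tu2 x x01; have pos : 0 < 1 + x * u by lra.
  have dlin : is_derive x 1 (fun y : R => y * u) u.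
    by have := is_deriveM (@is_derive_id R R x 1) (@is_derive_cst R R R u x 1);
      rewrite scaler0 add0r /GRing.scale /= mulr1.
  rewrite /g mulrBr; apply: cderivB.
    have dln : is_derive x 1 (fun y : R => ln (1 + y * u)) (u / (1 + x * u)).
      have l1 := is_derive1_ln pos.
      have l2 := is_deriveD (@is_derive_cst R R R 1 x 1) dlin.
      have := @is_derive1_comp R (@ln R) (cst 1 + ( *%R^~ u)) x _ _ l1 l2.
      by rewrite add0r mulrC.
    have := cderiv_cexp (- w) _ _ _ dln.
    congr cderiv; rewrite -!mulrA; congr (_ * _).
    rewrite opprD mulrDl cexpD mulN1r -rmorphN /= -lnV ?posrE //.
    rewrite {3}/cexp /= lnK ?posrE ?invr_gt0 // cos0 sin0 mulr0 mulr1.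
    by rewrite rmorphM /= -mulrA [RHS]mulrCA mulrC -!mulrA mulrC -!mulrA.
  have := cderiv_sum m.+1 (fun p y => fallc w p / p`!%:R * (y * u)%:C%C ^+ p) x
    (fun p => fallc w p / p`!%:R * (p%:R * (x * u) ^+ p.-1 * u)%:C%C).
  rewrite big_ord_recl /= !mul0r mulr0 add0r => h.
  rewrite [X in cderiv _ _ X](_ : _ = \sum_(i < m) fallc w (bump 0 i) / (bump 0
    i)`!%:R *
    ((bump 0 i)%:R * (x * u) ^+ (0 + i) * u)%:C%C).
    apply: h => -[p pm]; apply: cderivZ => /=.
    under eq_fun do rewrite -rmorphXn; apply: cderiv_real.
    by have := @is_deriveX R R (fun y => y * u) p x 1 u dlin; rewrite exprfctE.
  rewrite mulr_sumr; apply: eq_bigr => p _; rewrite /bump /= add1n /= fallcS.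
  rewrite !rmorphM rmorphXn rmorph_nat /= factS natrM rmorphM /=.
  have p1 : (p.+1%:R : C) != 0 by rewrite pnatr_eq0.
  have p2 : (p`!%:R : C) != 0 by rewrite pnatr_eq0 -lt0n fact_gt0.
  by field; rewrite p2 nat1r.
have fg x : 0 <= x <= t -> cabs (- w * u%:C%C * g x) <= B * `|u| * (K * (t * `|u|)
  ^+ m).
  move=> /andP[x0 xt]; rewrite !cabsM cabsN cabs_real.
  apply: ler_pM; rewrite ?mulr_ge0 ?cabs_ge0 //; first by rewrite ler_wpM2r.
  apply: le_trans (IH x _) _; first by rewrite x0 (le_trans xt).
  by rewrite ler_wpM2l // lerXn2r ?nnegrE ?mulr_ge0 // ler_wpM2r.
have := mean_value_cabs f (fun x => - w * u%:C%C * g x) _ t t0 fd fg.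
rewrite f0 subr0 => h; apply: le_trans h _.
have -> : 2 * (B * `|u| * (K * (t * `|u|) ^+ m)) * t =
  2 * B * K * (t * `|u|) ^+ m.+1 by rewrite exprS; ring.
apply: ler_wpM2r; first by rewrite exprn_ge0 ?mulr_ge0.
have eD : B + m.+1%:R = B + 1 + m%:R by rewrite -nat1r addrA.
rewrite eD /K exprS mulrA; apply: ler_wpM2r; first exact: expR_ge0.
apply: ler_wpM2r; first by rewrite exprn_ge0 // mulr_ge0 // !addr_ge0.
by rewrite ler_wpM2l // -addrA lerDl addr_ge0.
Qed.
End RealVariable.

Lemma sumB_nat (V : zmodType) (F : nat -> V) N n : (N <= n)%N ->
  \sum_(k < n) F k - \sum_(k < N) F k = \sum_(N <= k < n) F k.
Proof.
move=> Nn; rewrite -(big_mkord xpredT F) (@big_cat_nat _ _ _ N) //=.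
by rewrite big_mkord addrAC subrr add0r.
Qed.

Lemma series_tail (R : realType) (M : nat -> R) : (forall n, 0 <= M n) ->
  (exists B : R, forall n, \sum_(k < n) M k <= B) ->
  forall e : R, 0 < e -> exists N, forall n, (N <= n)%N -> \sum_(N <= k < n) M k <= e.
Proof.
move=> M0 [B MB] e e0; pose S (n : nat) : R := \sum_(k < n) M k.
have Smono : {homo S : m n / (m <= n)%N >-> m <= n}.
  apply: homo_leq => // [x y z|n]; first exact: le_trans.
  by rewrite /S big_ord_recr /= lerDl.
have Scvg : cvg (S @ \oo).
  apply: nondecreasing_is_cvgn => //.
  by exists B => _ [n _ <-]; exact: MB.
have /cvgrPdist_le /(_ (e / 2)) [|N _ HN] := Scvg; first by rewrite divr_gt0.
exists N => n Nn; rewrite -sumB_nat //.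
have := HN n Nn; have := HN N (leqnn N); rewrite /= !ler_norml.
by rewrite -/(S n) -/(S N) => /andP[? ?] /andP[? ?]; lra.
Qed.

Lemma ccvg_series (R : realType) (u : nat -> R[i]) (M : nat -> R) :
  (forall n, cabs (u n) <= M n) ->
  (exists B : R, forall n, \sum_(k < n) M k <= B) ->
  exists l, ccvg (fun n => \sum_(k < n) u k) l.
Proof.
move=> uM MB; have M0 n : 0 <= M n by apply: le_trans (cabs_ge0 _) (uM n).
have key N m n (e : R) : (N <= m <= n)%N -> \sum_(N <= k < n) M k <= e ->
    cabs (\sum_(k < n) u k - \sum_(k < m) u k) <= e.
  move=> /andP[Nm mn] /(le_trans _); apply; rewrite sumB_nat //.
  apply: le_trans (cabs_sum _ _ _ _) _.
  rewrite (@big_cat_nat _ _ _ m N) //=; apply: (@le_trans _ _ (\sum_(m <= k < n) M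
    k)).
    by apply: ler_sum => k _; exact: uM.
  by rewrite lerDr sumr_ge0.
apply: ccvg_cauchy => e e0; have [N HN] := series_tail _ _ M0 MB _ e0.
exists N => m n Nm Nn; have [mn|/ltnW nm] := leqP m n.
  by rewrite cabsC; apply: key (HN n Nn); rewrite Nm.
by apply: key (HN m Nm); rewrite Nn.
Qed.

(** * Differentiability of uniform limits of polynomials *)

Section UniformLimits.
Context {R : realType} {r : nat}.
Local Notation C := R[i].
Implicit Types (s t h : 'rV[C]_r) (f g : 'rV[C]_r -> C).

(* Stands in for holomorphy: the class is closed under uniform limits by
   definition, and is differentiable because Cauchy's estimate for polynomials
   (on complex lines through a point) passes to the limit. *)
Definition polylim s (rho : R) f := forall e : R, 0 < e ->
  exists2 p, polyfun p & forall t, norm1 (t - s) < rho -> cabs (f t - p t) <= e.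

Lemma polylim_poly s rho f : polyfun f -> polylim s rho f.
Proof.
by move=> fp e e0; exists f => // t _; rewrite subrr cabs0 ltW.
Qed.

Lemma polylim_lim s rho f :
  (forall e : R, 0 < e -> exists2 g, polylim s rho g &
    forall t, norm1 (t - s) < rho -> cabs (f t - g t) <= e) ->
  polylim s rho f.
Proof.
move=> fl e e0; have e2 : 0 < e / 2 by rewrite divr_gt0.
have [g gl fg] := fl _ e2; have [p pp gp] := gl _ e2.
exists p => // t ts; apply: le_trans (cabs_tri (g t) _ _) _.
have := fg t ts; have := gp t ts; lra.
Qed.

Lemma polylim_ext s rho f g : (forall t, norm1 (t - s) < rho -> f t = g t) ->
  polylim s rho f -> polylim s rho g.
Proof.
move=> fg fl; apply: polylim_lim => e e0; exists f => // t ts.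
by rewrite fg // subrr cabs0 ltW.
Qed.

Lemma polylim_bounded s rho f : polylim s rho f ->
  exists2 M : R, 0 < M & forall t, norm1 (t - s) < rho -> cabs (f t) <= M.
Proof.
move=> /(_ 1 ltr01)[p pp fp]; have [M HM] := polyfun_bounded p pp s rho.
exists (`|M| + 1); first by rewrite ltr_pwDr.
move=> t ts; rewrite -(subrK (p t) (f t)); apply: le_trans (cabsD _ _) _.
have := HM t (ltW ts); have := fp t ts; have := ler_norm M; lra.
Qed.

Lemma polylimD s rho f g : polylim s rho f -> polylim s rho g ->
  polylim s rho (fun t => f t + g t).
Proof.
move=> fl gl e e0; have e2 : 0 < e / 2 by rewrite divr_gt0.
have [p pp fp] := fl _ e2; have [q qp gq] := gl _ e2.
exists (fun t => p t + q t); first exact: polyfunD.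
move=> t ts; rewrite opprD addrACA; apply: le_trans (cabsD _ _) _.
have := fp t ts; have := gq t ts; lra.
Qed.

Lemma polylimM s rho f g : polylim s rho f -> polylim s rho g ->
  polylim s rho (fun t => f t * g t).
Proof.
move=> fl gl e e0.
have [M M0 fM] := polylim_bounded _ _ _ fl; have [N N0 gN] := polylim_bounded _ _ _
  gl.
(* The minimum with 1 bounds the approximant of [f] by [M + 1]. *)
have d0 : 0 < Num.min 1 (e / (M + N + 1)) by rewrite lt_min ltr01 divr_gt0 //; lra.
have [p pp fp] := fl _ d0; have [q qp gq] := gl _ d0.
exists (fun t => p t * q t); first exact: polyfunM.
move=> t ts; have := fp t ts; have := gq t ts; rewrite !le_min.
move=> /andP[gq1 gq2] /andP[fp1 fp2].
have -> : f t * g t - p t * q t = (f t - p t) * g t + p t * (g t - q t) by ring.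
apply: le_trans (cabsD _ _) _; rewrite !cabsM.
have pM : cabs (p t) <= M + 1.
  rewrite -(subrK (f t) (p t)); apply: le_trans (cabsD _ _) _.
  by rewrite cabsC; have := fM t ts; lra.
apply: (@le_trans _ _ (e / (M + N + 1) * N + (M + 1) * (e / (M + N + 1)))).
  by apply: lerD; apply: ler_pM; rewrite ?cabs_ge0 ?gN.
by rewrite le_eqVlt; apply/orP; left; apply/eqP; field; apply/eqP; lra.
Qed.

Lemma polylim_cst s rho c : polylim s rho (fun=> c).
Proof. by apply: polylim_poly; exact: polyfun_cst. Qed.

Lemma polylimX s rho f n : polylim s rho f -> polylim s rho (fun t => f t ^+ n).
Proof.
move=> fl; elim: n => [|n IH].
  by under eq_fun do rewrite expr0; exact: polylim_cst.
by under eq_fun do rewrite exprS; exact: polylimM.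
Qed.

Lemma polylim_sum s rho (I : Type) (q : seq I) (F : I -> 'rV[C]_r -> C) :
  (forall i, polylim s rho (F i)) -> polylim s rho (fun t => \sum_(i <- q) F i t).
Proof.
move=> Fl; elim: q => [|i q IH].
  by under eq_fun do rewrite big_nil; exact: polylim_cst.
by under eq_fun do rewrite big_cons; exact: polylimD.
Qed.

Lemma polylim_prod s rho (I : Type) (q : seq I) (F : I -> 'rV[C]_r -> C) :
  (forall i, polylim s rho (F i)) -> polylim s rho (fun t => \prod_(i <- q) F i t).
Proof.
move=> Fl; elim: q => [|i q IH].
  by under eq_fun do rewrite big_nil; exact: polylim_cst.
by under eq_fun do rewrite big_cons; exact: polylimM.
Qed.

Lemma polylim_cexp s rho f : polylim s rho f -> polylim s rho (fun t => cexp (f t)).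
Proof.
move=> fl; have [M M0 fM] := polylim_bounded _ _ _ fl.
apply: polylim_lim => e e0.
pose K := 4 * expR 1 * M ^+ 2 * expR M.
(* [n + 1] must exceed [M] for [cexp_euler] to apply, and [K / e] for its bound to be at most
   [e]. *)
pose n := Num.truncn (Num.max M (K / e)).
have nM : M < n.+1%:R /\ K / e < n.+1%:R.
  by apply/andP; rewrite -gt_max truncnS_gt.
exists (fun t => (1 + f t / n.+1%:R) ^+ n.+1).
  apply: polylimX; apply: polylimD; first exact: polylim_cst.
  by apply: polylimM => //; exact: polylim_cst.
move=> t ts; have ftM := fM t ts.
apply: le_trans (cexp_euler _ n _) _; first by rewrite ltW // (le_lt_trans ftM) ?nM.1.
apply: (@le_trans _ _ (K / n.+1%:R)).
  rewrite ler_pM2r ?invr_gt0 ?ltr0Sn //; apply: ler_pM.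
  - by rewrite !mulr_ge0 ?exprn_ge0 ?expR_ge0 ?cabs_ge0.
  - exact: expR_ge0.
  - rewrite ler_wpM2l ?mulr_ge0 ?expR_ge0 // lerXn2r ?nnegrE ?cabs_ge0 //.
    exact: ltW.
  - by rewrite ler_expR.
rewrite ler_pdivrMr ?ltr0Sn // mulrC -ler_pdivrMr //; exact: ltW nM.2.
Qed.

Lemma polylim_series s rho (f : nat -> 'rV[C]_r -> C) (M : nat -> R) F :
  (forall n, polylim s rho (f n)) ->
  (forall n t, norm1 (t - s) < rho -> cabs (f n t) <= M n) ->
  (exists B : R, forall n, \sum_(k < n) M k <= B) ->
  (forall t, norm1 (t - s) < rho -> ccvg (fun n => \sum_(k < n) f k t) (F t)) ->
  polylim s rho F.
Proof.
move=> fl fM [B MB] Ft.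
have [rho0|rho0] := lerP rho 0.
  move=> e e0; exists (fun=> 0); first exact: polyfun_cst.
  by move=> t ts; have := le_lt_trans (norm1_ge0 (t - s)) ts; rewrite ltNge rho0.
have M0 n : 0 <= M n.
  by apply: le_trans (cabs_ge0 _) (fM n s _); rewrite subrr norm1_0.
apply: polylim_lim => e e0; have [N HN] := series_tail _ _ M0 (ex_intro _ B MB) _ e0.
exists (fun t => \sum_(k < N) f k t).
  by have := polylim_sum s rho _ (index_enum 'I_N) _ (fun k : 'I_N => fl k).
move=> t ts; apply: (@ccvg_bound R (fun n => \sum_(k < n) f k t - \sum_(k < N) f k
  t)).
  by apply: ccvgB; [exact: Ft | exact: ccvg_cst].
exists N => n Nn.
rewrite (sumB_nat _ (fun k => f k t)) //.
apply: le_trans (cabs_sum _ _ _ _) _.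
by apply: le_trans (HN n Nn); apply: ler_sum => k _; exact: fM.
Qed.

(** By [polyfun_linear_coef] the gradients of the approximants form a Cauchy sequence. Their limit
    is the differential of [f], because the quadratic bound of [polyfun_quadratic] has the same
    constant for all approximants and passes to the limit. *)
Lemma polylim_differentiable s rho (f : 'rV[C]_r -> C^o) t :
  polylim s rho f -> norm1 (t - s) < rho -> differentiable f t.
Proof.
move=> fl ts; pose e := (rho - norm1 (t - s)) / 2.
have e0 : 0 < e by rewrite divr_gt0 // subr_gt0.
have ball h : norm1 h <= e -> norm1 (t + h - s) < rho.
  move=> he; rewrite addrAC; apply: le_lt_trans (norm1D _ _) _.
  by rewrite /e in he e0 *; lra.
clearbody e.
have [M M0 fM] := polylim_bounded _ _ _ fl.
have pos m : 0 < (m.+1%:R^-1 : R) by rewrite invr_gt0.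
have ex m : exists p, [/\ polyfun p,
    forall t, norm1 (t - s) < rho -> cabs (f t - p t) <= m.+1%:R^-1 & True].
  by have [p pp fp] := fl _ (pos m); exists p.
have [p Hp] := choice ex.
have ed m : exists d : 'I_r -> C, forall h, exists q : {poly C},
    (forall z, p m (t + z *: h) = q.[z]) /\ q`_1 = \sum_(l < r) h 0 l * d l.
  by have [pm _ _] := Hp m; exact: polyfun_line.
have [d Hd] := choice ed.
have pM m h : norm1 h <= e -> cabs (p m (t + h)) <= M + 1.
  move=> he; rewrite -(subrK (f (t + h)) (p m _)); apply: le_trans (cabsD _ _) _.
  rewrite addrC cabsC lerD ?fM ?ball //; have [_ h1 _] := Hp m.
  by apply: le_trans (h1 _ (ball _ he)) _; rewrite invf_le1 // ler1n.
have dC l : exists dl, ccvg (fun m => d m l) dl.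
  apply: ccvg_cauchy => x x0.
  (* From index [N] on, two approximants differ by at most [x * e] on the ball of radius [e], hence
     their gradients by at most [x]. *)
  pose N := Num.truncn (2 / (x * e)).
  have HN : 2 / (x * e) < N.+1%:R by rewrite truncnS_gt.
  exists N => m n Nm Nn.
  have inv k : (N <= k)%N -> k.+1%:R^-1 <= x * e / 2.
    move=> Nk; rewrite -[X in _ <= X]invrK lef_pV2 ?posrE ?invr_gt0 ?divr_gt0
      ?mulr_gt0 //.
    by rewrite invf_div ltW // (lt_le_trans HN) // ler_nat ltnS.
  rewrite -(ler_pM2r e0).
  apply: (polyfun_linear_coef (fun t => p m t - p n t) t (fun l => d m l - d n l))
    => //.
    move=> h; have [q [q1 q2]] := Hd m h; have [q' [q1' q2']] := Hd n h.
    exists (q - q'); split => [z|]; first by rewrite hornerD hornerN q1 q1'.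
    by rewrite coefB q2 q2' -sumrB; apply: eq_bigr => i _; rewrite mulrBr.
  move=> h he; have [_ h1 _] := Hp m; have [_ h2 _] := Hp n.
  apply: le_trans (cabs_tri (f (t + h)) _ _) _; rewrite cabsC.
  have := le_trans (h1 _ (ball _ he)) (inv _ Nm).
  by have := le_trans (h2 _ (ball _ he)) (inv _ Nn); lra.
have [dl Hdl] := choice dC.
have pf u : norm1 (u - s) < rho -> ccvg (fun m => p m u) (f u).
  move=> us x x0; exists (Num.truncn x^-1) => n Nn; rewrite cabsC.
  have [_ h1 _] := Hp n; apply: le_trans (h1 _ us) _.
  rewrite -[x]invrK lef_pV2 ?posrE ?invr_gt0 // ltW //.
  by apply: lt_le_trans (truncnS_gt _) _; rewrite ler_nat ltnS.
apply: (@differentiable_quadratic _ _ f t dl (2 * (M + 1) / e ^+ 2) (e / 2)).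
  by rewrite divr_gt0.
move=> h he.
have he' : norm1 h <= e by apply: le_trans (ltW he) _; rewrite ler_pdivrMr //; lra.
apply: (@ccvg_bound R
    (fun m => p m (t + h) - p m t - \sum_(l < r) h 0 l * d m l)).
  apply: ccvgB; first by apply: ccvgB; apply: pf => //; exact: ball.
  by apply: ccvg_sum => l; exact: ccvgZ.
by exists 0%N => m _; apply: polyfun_quadratic => //; [exact: pM | exact: ltW].
Qed.

Lemma polylim_holomorphic s rho (f : 'rV[C]_r -> C^o) : 0 < rho ->
  polylim s rho f -> holomorphic_at f s.
Proof.
move=> rho0 fl; apply/near_norm1P; exists rho => // t ts.
exact: polylim_differentiable ts.
Qed.

End UniformLimits.

(** * Nested sums *)

Section NestedSums.

(* Sum over [K >= n_1 > ... > n_r > 0] of [a 0 n_1 * ... * a (r - 1) n_r]; the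
   bound index [n] stands for [n_1 = n + 1]. *)
Fixpoint nsum (T : pzSemiRingType) (r : nat) (a : nat -> nat -> T) (K : nat) : T :=
  if r is r'.+1 then
    \sum_(n < K) a 0%N n.+1 * nsum T r' (fun l => a l.+1) n
  else 1.

Lemma nsumS (T : pzSemiRingType) r (a : nat -> nat -> T) K :
  nsum T r.+1 a K = \sum_(n < K) a 0%N n.+1 * nsum T r (fun l => a l.+1) n.
Proof. by []. Qed.

Lemma nsum_ext (T : pzSemiRingType) r (a b : nat -> nat -> T) K :
  (forall l n, (l < r)%N -> a l n.+1 = b l n.+1) -> nsum T r a K = nsum T r b K.
Proof.
elim: r a b K => [//|r IH] a b K ab /=; apply: eq_bigr => n _.
by rewrite ab // (IH _ (fun l => b l.+1)) // => l n' lr; rewrite ab.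
Qed.

Context {R : realType}.
Local Notation C := R[i].

Lemma cabs_nsum r (a : nat -> nat -> C) (b : nat -> nat -> R) K :
  (forall l n, (l < r)%N -> cabs (a l n.+1) <= b l n.+1) ->
  cabs (nsum C r a K) <= nsum R r b K.
Proof.
elim: r a b K => [|r IH] a b K ab /=.
  by rewrite -[X in X <= _]/(cabs 1) cabs1.
apply: le_trans (cabs_sum _ _ _ _) _; apply: ler_sum => n _; rewrite cabsM.
by apply: ler_pM; rewrite ?cabs_ge0 ?ab // IH // => l n' lr; rewrite ab.
Qed.

Lemma nsum_ge0 r (b : nat -> nat -> R) K :
  (forall l n, (l < r)%N -> 0 <= b l n.+1) -> 0 <= nsum R r b K.
Proof.
elim: r b K => [|r IH] b K b0 /=; first exact: ler01.
by apply: sumr_ge0 => n _; rewrite mulr_ge0 ?b0 // IH // => l n' lr; rewrite b0.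
Qed.

(* Since [ln 0 = 0], [rpow 0 s = 1]. *)
Definition rpow (x s : R) := expR (s * ln x).

Lemma rpow_gt0 x s : 0 < rpow x s. Proof. exact: expR_gt0. Qed.
Lemma rpow_ge0 x s : 0 <= rpow x s. Proof. exact: expR_ge0. Qed.

Lemma rpowD x s t : rpow x (s + t) = rpow x s * rpow x t.
Proof. by rewrite /rpow mulrDl expRD. Qed.

Lemma rpow0 x : rpow x 0 = 1. Proof. by rewrite /rpow mul0r expR0. Qed.

Lemma rpowN x s : rpow x (- s) = (rpow x s)^-1.
Proof. by rewrite /rpow mulNr expRN. Qed.

Lemma ln_nat_ge0 n : 0 <= ln (n%:R : R).
Proof.
case: n => [|n]; first by rewrite ln0.
by rewrite ln_ge0 // ler1n.
Qed.

Lemma ler_rpow_nat m n s : 0 <= s -> (m <= n)%N -> rpow m%:R s <= rpow n%:R s.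
Proof.
move=> s0 mn; rewrite ler_expR ler_wpM2l //; case: m mn => [|m] mn.
  by rewrite [X in X <= _]ln0 // ln_nat_ge0.
rewrite ler_ln ?posrE ?ltr0n ?(leq_trans _ mn) //.
by rewrite ler_nat.
Qed.

Lemma ler_rpow_exp n s t : s <= t -> rpow n%:R s <= rpow n%:R t.
Proof. by move=> st; rewrite ler_expR ler_wpM2r // ln_nat_ge0. Qed.

(** A telescoping substitute for the integral test: with [d = ln ((n + 2) / (n + 1))], one has
    [expR (e d) - 1 >= e d] and [d >= 1 / (n + 2)]. *)
Lemma rpow_series_term n (e : R) : 0 < e ->
  rpow n.+2%:R (- 1 - e) <= e^-1 * (rpow n.+1%:R (- e) - rpow n.+2%:R (- e)).
Proof.
move=> e0; rewrite -(ler_pM2l e0) mulrA mulfV ?gt_eqF // mul1r.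
have n1 : 0 < (n.+1%:R : R) by rewrite ltr0Sn.
have n2 : 0 < (n.+2%:R : R) by rewrite ltr0Sn.
pose d := ln (n.+2%:R : R) - ln (n.+1%:R : R).
have -> : rpow n.+1%:R (- e) = rpow n.+2%:R (- e) * expR (e * d).
  by rewrite /rpow -expRD; congr expR; rewrite /d; ring.
have -> : - 1 - e = - e + - 1 by rewrite addrC.
rewrite rpowD mulrCA -[X in _ - X]mulr1 -mulrBr ler_pM2l ?rpow_gt0 //.
apply: (@le_trans _ _ (e * d)); last by rewrite lerBrDl expR_ge1Dx.
rewrite ler_pM2l // /rpow mulN1r expRN lnK ?posrE //.
have -> : d = - ln (1 - n.+2%:R^-1).
  rewrite /d -opprB -ln_div ?posrE //; congr (- ln _).
  rewrite -(natr1 n.+1) in n2 *; set x := n.+1%:R in n2 *.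
  by field; rewrite lt0r_neq0.
rewrite lerNr; apply: le_trans (le_ln1Dx _) _ => //.
by rewrite ltrN2 invf_lt1 // ltr1n.
Qed.

Lemma rpow_series_bound (e : R) : 0 < e ->
  exists2 B : R, 0 <= B & forall n, \sum_(k < n) rpow k.+1%:R (- 1 - e) <= B.
Proof.
move=> e0; exists (1 + e^-1); first by rewrite addr_ge0 // invr_ge0 ltW.
suff S n : \sum_(k < n.+1) rpow k.+1%:R (- 1 - e) <=
    1 + e^-1 * (1 - rpow n.+1%:R (- e)).
  case=> [|n]; first by rewrite big_ord0 addr_ge0 // invr_ge0 ltW.
  apply: le_trans (S n) _; rewrite lerD2l ger_pMr ?invr_gt0 //.
  by rewrite gerBl rpow_ge0.
elim: n => [|n IH].
  by rewrite big_ord1 /rpow ln1 !mulr0 expR0 subrr mulr0 addr0.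
rewrite big_ord_recr /=; have := rpow_series_term n _ e0.
by have := IH; set x := \sum_(_ < _) _; rewrite !mulrBr; lra.
Qed.

Lemma uniform_gap (g : nat -> R) r : (forall i, (1 <= i <= r)%N -> 0 < g i) ->
  exists2 e, 0 < e & forall i, (1 <= i <= r)%N -> e < g i.
Proof.
elim: r => [|r IH] g0.
  by exists 1 => // i /andP[i1 i0]; have := leq_trans i1 i0.
have [|e e0 He] := IH.
  by move=> i /andP[i1 ir]; rewrite g0 // i1 ltnW.
have gr : 0 < g r.+1 by rewrite g0 //= ltnSn.
exists (Num.min e (g r.+1 / 2)); first by rewrite lt_min e0 divr_gt0.
move=> i /andP[i1]; rewrite leq_eqVlt => /orP[/eqP ->|ir].
  by rewrite gt_min; apply/orP; right; lra.
by rewrite gt_min He // i1 -ltnS.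
Qed.

(** [theta] is the growth conceded to the sum as the bound on [n_1] increases. By induction the
    inner sum grows at most like [n] to the power [theta + tau_0 - 1 - e]; condition [i = 1] makes
    this exponent nonnegative, and condition [i + 1] becomes condition [i] of the inner sum. The
    slack [e] has to be common to all the conditions. *)
Lemma nsum_term_bound r (c : nat -> R) (tau : nat -> R) (theta : R) :
  (forall l, 0 <= c l) -> 0 <= theta ->
  (forall i, (1 <= i <= r.+1)%N -> i%:R < theta + \sum_(l < i) tau l) ->
  exists2 e, 0 < e & exists2 B, 0 <= B & forall n,
    c 0%N * rpow n.+1%:R (- tau 0%N) *
      nsum R r (fun l n => c l.+1 * rpow n%:R (- tau l.+1)) n
    <= B * rpow n.+1%:R (theta - 1 - e).
Proof.
elim: r c tau theta => [|r IH] c tau theta c0 t0 ht.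
  exists (theta + tau 0%N - 1).
    by have := ht 1%N isT; rewrite big_ord1; lra.
  exists (c 0%N) => // n /=; rewrite mulr1.
  by rewrite (_ : - tau 0%N = theta - 1 - (theta + tau 0%N - 1)) //; ring.
have [|e e0 He] := uniform_gap
    (fun i => theta + \sum_(l < i) tau l - i%:R) r.+2.
  by move=> i /ht; rewrite subr_gt0.
have ht1 := He 1%N isT; rewrite big_ord1 in ht1.
exists e => //; pose th := theta + tau 0%N - 1 - e.
have th0 : 0 <= th by rewrite /th; lra.
have [|||d d0 [B B0 HB]] := IH (fun l => c l.+1) (fun l => tau l.+1) th => //.
  move=> i /andP[i1 ir]; have := He i.+1 (introT andP (conj (ltn0Sn i) ir)).
  by rewrite big_ord_recl -natr1 /= /th; set S := \sum_(_ < _) _; lra.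
have [D D0 HD] := rpow_series_bound d d0.
exists (c 0%N * (B * D)); first by rewrite !mulr_ge0.
move=> n; rewrite /= -!mulrA; apply: ler_wpM2l => //.
have -> : theta - 1 - e = - tau 0%N + th by rewrite /th; ring.
rewrite rpowD (_ : forall p q : R, B * (D * (p * q)) = p * (B * q * D)); last first.
  by move=> p q; ring.
apply: ler_wpM2l; first exact: rpow_ge0.
apply: (@le_trans _ _ (\sum_(k < n) B * rpow n.+1%:R th * rpow k.+1%:R (-1 - d))).
  apply: ler_sum => k _; apply: le_trans (HB k) _.
  rewrite -mulrA; apply: ler_wpM2l => //.
  rewrite (_ : th - 1 - d = th + (-1 - d)); last by ring.
  rewrite rpowD; apply: ler_wpM2r; first exact: rpow_ge0.
  by apply: ler_rpow_nat => //; rewrite ltnS ltnW.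
by rewrite -mulr_sumr; apply: ler_wpM2l; rewrite ?mulr_ge0 ?rpow_ge0.
Qed.

Definition majorant (c tau : nat -> R) (l n : nat) : R := c l * rpow n%:R (- tau l).

Lemma majorant_ge0 c tau l n : (forall l, 0 <= c l) -> 0 <= majorant c tau l n.
Proof. by move=> c0; rewrite mulr_ge0 ?rpow_ge0. Qed.

Lemma nsum_growth r (c tau : nat -> R) (theta : R) :
  (forall l, 0 <= c l) -> 0 <= theta ->
  (forall i, (1 <= i <= r)%N -> i%:R < theta + \sum_(l < i) tau l) ->
  exists2 B, 0 <= B & forall K, nsum R r (majorant c tau) K <= B * rpow K%:R theta.
Proof.
case: r => [|r] c0 t0 ht.
  exists 1 => // K /=; rewrite mul1r.
  by apply: le_trans (ler_rpow_exp K _ _ t0); rewrite rpow0.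
have [e e0 [B B0 HB]] := nsum_term_bound r c tau theta c0 t0 ht.
have [D D0 HD] := rpow_series_bound e e0.
exists (B * D); first exact: mulr_ge0.
move=> K /=; apply: (@le_trans _ _
    (\sum_(k < K) B * rpow K%:R theta * rpow k.+1%:R (-1 - e))).
  apply: ler_sum => k _; apply: le_trans (HB k) _.
  rewrite -mulrA; apply: ler_wpM2l => //.
  rewrite (_ : theta - 1 - e = theta + (-1 - e)); last by ring.
  rewrite rpowD; apply: ler_wpM2r; first exact: rpow_ge0.
  exact: ler_rpow_nat.
rewrite -mulr_sumr mulrAC; apply: ler_wpM2r; first exact: rpow_ge0.
by apply: ler_wpM2l.
Qed.

Lemma nsum_summable r (c tau : nat -> R) : (forall l, 0 <= c l) ->
  (forall i, (1 <= i <= r)%N -> i%:R < \sum_(l < i) tau l) ->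
  exists B, forall K, nsum R r (majorant c tau) K <= B.
Proof.
move=> c0 ht; have [|B B0 HB] := nsum_growth r c tau 0 c0 (lexx _).
  by move=> i /ht; rewrite add0r.
by exists B => K; have := HB K; rewrite rpow0 mulr1.
Qed.

Lemma rpow_decay (e : R) (B : R) : 0 < e -> 0 <= B -> forall x, 0 < x ->
  exists N, forall n, (N <= n)%N -> B * rpow n%:R (- e) <= x.
Proof.
move=> e0 B0 x x0.
pose N := (Num.truncn (expR (e^-1 * ln ((B + 1) / x)))).+1.
exists N => n Nn; have Bx : 0 < (B + 1) / x by rewrite divr_gt0 //; lra.
have n0 : 0 < (n%:R : R) by rewrite ltr0n (leq_trans _ Nn).
have h : e^-1 * ln ((B + 1) / x) <= ln n%:R.
  rewrite -ler_expR lnK ?posrE // ltW // (lt_le_trans (truncnS_gt _)) //.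
  by rewrite ler_nat.
have h2 : (B + 1) / x <= rpow n%:R e.
  rewrite -[leLHS]lnK ?posrE // ler_expR.
  by rewrite -ler_pdivrMl.
rewrite rpowN ler_pdivrMr ?rpow_gt0 //; rewrite ler_pdivrMr // in h2.
by rewrite mulrC; lra.
Qed.

Lemma nsum_decay r (c tau : nat -> R) (sigma : R) : (forall l, 0 <= c l) ->
  0 < sigma -> (forall i, (1 <= i <= r)%N -> i%:R < sigma + \sum_(l < i) tau l) ->
  forall A x : R, 0 <= A -> 0 < x -> exists N, forall n, (N <= n)%N ->
    A * rpow n%:R (- sigma) * nsum R r (majorant c tau) n <= x.
Proof.
move=> c0 s0 ht A x A0 x0.
have [|e e0 He] := uniform_gap (fun i => sigma + \sum_(l < i) tau l - i%:R) r.
  by move=> i /ht; rewrite subr_gt0.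
(* Conceding the growth [sigma - d], which is nonnegative and still meets the conditions, leaves the
   decay [n ^ (- d)]. *)
pose d := Num.min e sigma; have d0 : 0 < d by rewrite lt_min e0.
have de : d <= e by rewrite ge_min lexx.
have ds : d <= sigma by rewrite ge_min lexx orbT.
have [||B B0 HB] := nsum_growth r c tau (sigma - d) c0; first by rewrite subr_ge0.
  by move=> i /He; lra.
have [N HN] := rpow_decay d (A * B) d0 (mulr_ge0 A0 B0) x x0.
exists N => n Nn; apply: le_trans (HN n Nn).
rewrite -!mulrA; apply: ler_wpM2l => //.
apply: le_trans (ler_wpM2l (rpow_ge0 _ _) (HB n)) _.
by rewrite mulrCA -rpowD addrA addNr add0r.
Qed.

End NestedSums.

(** * Nested sums as unconditional sums over the index set *)

Section UnconditionalSums.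

Fixpoint decreasing_lists (r K : nat) : seq (seq nat) :=
  if r is r'.+1 then
    flatten [seq [seq n.+1 :: t | t <- decreasing_lists r' n] | n <- iota 0 K]
  else [:: [::]].

Lemma nsumE (T : comNzRingType) r (a : nat -> nat -> T) K :
  nsum T r a K = \sum_(t <- decreasing_lists r K) \prod_(l < r) a l (nth 0%N t l).
Proof.
elim: r a K => [|r IH] a K /=; first by rewrite big_seq1 big_ord0.
rewrite big_flatten big_map /=.
rewrite -(big_mkord xpredT (fun n => a 0%N n.+1 * nsum T r (fun l => a l.+1) n)).
rewrite /index_iota subn0; apply: eq_bigr => n _; rewrite IH big_map mulr_sumr;
  apply: eq_bigr => t _.
by rewrite big_ord_recl.
Qed.

Lemma mem_decreasing_lists r K t : (t \in decreasing_lists r K) =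
  [&& size t == r, sorted gtn t, all (ltn 0%N) t & all (fun n => n <= K)%N t].
Proof.
have gtn_trans : transitive gtn by move=> y x z xy yz; exact: ltn_trans yz xy.
elim: r K t => [|r IH] K t.
  by rewrite inE -size_eq0; case: t => //=.
apply/flattenP/idP => [[u /mapP[n]]|].
  rewrite mem_iota add0n => /= nK -> /mapP[t']; rewrite IH => /and4P[/eqP sz so po
    le] ->.
  rewrite /= sz eqxx po /= nK path_sortedE // so andbT /=; apply/andP; split.
    by apply: sub_all le => x; rewrite /gtn /= ltnS.
  by apply: sub_all le => x xn; exact: leq_trans xn (ltnW nK).
case: t => [//|n t].
rewrite /= eqSS path_sortedE // => /and4P[sz /andP[lt so] /andP[n0 po] /andP[nK le]].
exists [seq n.-1.+1 :: t | t <- decreasing_lists r n.-1].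
  by apply/mapP; exists n.-1 => //; rewrite mem_iota; case: n n0 nK {lt}.
rewrite prednK //; apply/mapP; exists t => //; rewrite IH sz so po /=.
by apply: sub_all lt => x; rewrite /gtn /=; case: n n0 {nK}.
Qed.

Lemma uniq_decreasing_lists r K : uniq (decreasing_lists r K).
Proof.
elim: r K => [//|r IH] K /=; elim: K => [//|K IHK].
rewrite -addn1 iotaD map_cat flatten_cat cat_uniq IHK /= add0n cats0.
rewrite map_inj_uniq ?IH ?andbT; last by move=> x y [].
apply/hasPn => t /mapP[u _ ->]; apply/negP => /flattenP[v /mapP[n]].
by rewrite mem_iota => /= nK -> /mapP[w _ [e _]]; move: nK; rewrite e ltnn.
Qed.

Lemma sum_mem (V : nmodType) (T : eqType) (s s' : seq T) (F : T -> V) :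
  uniq s -> uniq s' -> {subset s <= s'} ->
  \sum_(t <- s) F t = \sum_(t <- s' | t \in s) F t.
Proof.
move=> us us' ss'; rewrite -[RHS]big_filter; apply: perm_big; apply: uniq_perm => //.
  exact: filter_uniq.
move=> t; rewrite mem_filter; apply/idP/andP => [ts|[] //].
by split => //; exact: ss'.
Qed.

Context {R : realType}.
Local Notation C := R[i].

Lemma nsum_cauchy r (b : nat -> nat -> R) :
  (forall l n, 0 <= b l n) -> (exists B, forall K, nsum R r b K <= B) ->
  forall e : R, 0 < e -> exists N, forall m n, (N <= m)%N -> (m <= n)%N ->
    nsum R r b n - nsum R r b m <= e.
Proof.
case: r => [|r] b0 [B HB] e e0; first by exists 0%N => m n _ _ /=; rewrite subrr ltW.
have t0 k : 0 <= b 0%N k.+1 * nsum R r (fun l => b l.+1) k.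
  by rewrite mulr_ge0 // nsum_ge0.
have [N HN] := @series_tail R _ t0 (ex_intro _ B HB) e e0.
exists N => m n Nm mn /=.
rewrite (sumB_nat _ (fun k => b 0%N k.+1 * nsum R r (fun l => b l.+1) k)) //.
apply: le_trans (HN n (leq_trans Nm mn)).
by rewrite [leRHS](@big_cat_nat _ _ _ m) //= lerDr sumr_ge0.
Qed.

(** A finite set containing all indices with [n_1 <= K] lies among those with [n_1 <= K'] for some
    [K']. What it adds to the nested sum up to [K] is dominated by the increase of the majorant from
    [K] to [K'], which [nsum_cauchy] makes small. *)
Lemma sum_lerch_index r (a : nat -> nat -> C) (b : nat -> nat -> R) (L : C) :
  (forall l n, (l < r)%N -> cabs (a l n.+1) <= b l n.+1) ->
  (forall l n, 0 <= b l n) -> (exists B, forall K, nsum R r b K <= B) ->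
  ccvg (nsum C r a) L ->
  summability.sum (fun n : lerch_index r => \prod_(l < r) a l (tnth (val n) l) :
    C^o) = L.
Proof.
move=> ab b0 bB aL; pose I := lerch_index r.
set x := (X in summability.sum X).
pose P (t : seq nat) := \prod_(l < r) a l (nth 0%N t l).
pose Pb (t : seq nat) := \prod_(l < r) b l (nth 0%N t l).
have PPb K t : t \in decreasing_lists r K -> cabs (P t) <= Pb t.
  rewrite mem_decreasing_lists => /and4P[/eqP sz _ /allP po _].
  rewrite cabs_prod; apply: ler_prod => l _; rewrite cabs_ge0 /=.
  have : (0 < nth 0%N t l)%N by apply: po; rewrite mem_nth // sz.
  by case: (nth 0%N t l) => // n _; exact: ab.
pose val' (i : I) : seq nat := val (val i).
have val'_inj : injective val' by move=> i j /val_inj/val_inj.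
have val'P i : exists K, val' i \in decreasing_lists r K.
  exists (\max_(n <- val' i) n)%N; rewrite mem_decreasing_lists /val'.
  have /andP[so po] := valP i; rewrite size_tuple eqxx so po /=.
  by apply/allP => n ni; exact: leq_bigmax_seq.
have sE (A : {fset I}) : summability.partial_sum x A =
    \sum_(t <- map val' (enum_fset A)) P t.
  rewrite /summability.partial_sum big_map.
  rewrite -(big_seq_fsetE _ _ xpredT x) /=; apply: eq_bigr => i _.
  by apply: eq_bigr => l _; rewrite (tnth_nth 0%N).
pose toI (t : seq nat) : option I :=
  obind insub (insub t : option (r.-tuple nat)).
have toIK K t : t \in decreasing_lists r K -> exists2 i, toI t = Some i & val' i = t.
  rewrite mem_decreasing_lists => /and4P[sz so po _].
  rewrite /toI; case: insubP => [u /= _ ut|]; last by rewrite sz.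
  case: insubP => [i _ iu|]; last by rewrite ut so po.
  by exists i => //; rewrite /val' iu.
pose AK K : {fset I} := [fset i in pmap toI (decreasing_lists r K)]%fset.
have AKP K t : t \in decreasing_lists r K -> exists2 i, i \in AK K & val' i = t.
  move=> tK; have [i ti it] := toIK K t tK; exists i => //.
  by rewrite !inE mem_pmap -ti map_f.
apply: (@cvg_lim _ (@norm_hausdorff _ C^o) _ _ (summability.totally_filter)).
apply/(@cvgrPdist_le _ _ _ _ (summability.totally_filter)) => eps eps0.
have epsR : eps = (complex.Re eps)%:C%C by rewrite RRe_real // gtr0_real.
set e := complex.Re _ in epsR.
have e0 : 0 < e by rewrite epsR ltcR in eps0.
have e2 : 0 < e / 2 by rewrite divr_gt0.
have [N1 H1] := nsum_cauchy r b b0 bB _ e2; have [N2 H2] := aL _ e2.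
pose K := maxn N1 N2.
exists (AK K) => // A /= KA.
rewrite normr_cabs epsR lecR sE.
rewrite (_ : L - _ = (L - nsum C r a K) +
    (nsum C r a K - \sum_(t <- map val' (enum_fset A)) P t));
      last by rewrite addrA subrK.
apply: le_trans (cabsD _ _) _.
have := H2 K (leq_maxr _ _); rewrite cabsC => h2.
suff : cabs (nsum C r a K - \sum_(t <- map val' (enum_fset A)) P t) <= e / 2 by lra.
have [K' KK' AK'] : exists2 K', (K <= K')%N &
    {subset map val' (enum_fset A) <= decreasing_lists r K'}.
  elim: (enum_fset A) => [|i s [K1 KK1 HK1]]; first by exists K.
  have [K2 HK2] := val'P i; exists (maxn K1 K2).
    by rewrite leq_max KK1.
  have mono k k' : (k <= k')%N -> {subset decreasing_lists r k <= decreasing_lists r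
    k'}.
    move=> kk t; rewrite !mem_decreasing_lists => /and4P[-> -> -> /= h].
    by apply: sub_all h => n nk; exact: leq_trans kk.
  move=> t; rewrite inE => /orP[/eqP ->|/HK1 h].
    by apply: mono HK2; exact: leq_maxr.
  by apply: mono h; exact: leq_maxl.
have sub1 : {subset decreasing_lists r K <= map val' (enum_fset A)}.
  move=> t /AKP[i iK <-]; apply: map_f.
  by move/fsubsetP: KA; apply.
rewrite nsumE -/P (sum_mem _ _ _ (decreasing_lists r K')) ?uniq_decreasing_lists //;
  last first.
  by move=> t /sub1/AK'.
rewrite (sum_mem _ _ (map val' _) (decreasing_lists r K')) ?uniq_decreasing_lists
  //; last first.
  by rewrite map_inj_uniq // fset_uniq.
set S := map _ _ in sub1 AK' *.
rewrite cabsC (bigID (mem (decreasing_lists r K)) (mem S)) /=.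
rewrite [X in X + _ - _](eq_bigl (mem (decreasing_lists r K))); last first.
  by move=> t /=; apply: andb_idl; exact: sub1.
rewrite addrAC subrr add0r.
apply: le_trans (cabs_sum _ _ _ _) _.
have bK := H1 K K' (leq_maxl _ _) KK'.
apply: le_trans bK; rewrite !nsumE -/Pb.
rewrite [X in _ <= _ - X](sum_mem _ _ _ (decreasing_lists r K'))
  ?uniq_decreasing_lists //; last first.
  by move=> t /sub1/AK'.
rewrite [X in _ <= X - _](bigID (mem (decreasing_lists r K))) /= [leRHS]addrAC subrr
  add0r.
have Pb0 t : 0 <= Pb t by apply: prodr_ge0 => l _.
rewrite big_seq_cond [leRHS]big_seq_cond.
apply: (@le_trans _ _ (\sum_(t <- decreasing_lists r K' |
   [&& t \in decreasing_lists r K', t \in S & t \notin decreasing_lists r K]) Pb t)).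
  by apply: ler_sum => t /andP[tK' _]; exact: PPb tK'.
rewrite [leRHS](bigID (mem S)) /= -[leLHS]addr0; apply: lerD; last first.
  apply: sumr_ge0 => t _. exact: Pb0.
rewrite le_eqVlt; apply/orP; left; apply/eqP; apply: eq_bigl => t.
by rewrite -!andbA; case: (t \in _) => //=; rewrite andbC.
Qed.

End UnconditionalSums.

(** * Summation of powers *)

Section EulerMaclaurinCoefficients.
Context {R : realType}.
Local Notation C := R[i].

Lemma recursive_sequence (F : pzRingType) (c : nat -> nat -> F) (d : nat -> F) :
  exists k : nat -> F, forall m, k m = d m + \sum_(q < m) c m q * k q.
Proof.
pose fix s n : seq F := if n is n'.+1 then
  rcons (s n') (d n' + \sum_(q < n') c n' q * (s n')`_q) else [::].
have sz n : size (s n) = n by elim: n => //= n IH; rewrite size_rcons IH.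
pose k q := (s q.+1)`_q.
have sk n q : (q < n)%N -> (s n)`_q = k q.
  elim: n => [//|n IH]; rewrite ltnS leq_eqVlt => /orP[/eqP -> //|qn].
  by rewrite /= nth_rcons sz qn IH.
exists k => m; rewrite /k /= nth_rcons sz ltnn eqxx; congr (_ + _).
by apply: eq_bigr => q _; rewrite sk.
Qed.

(** The coefficient of [X ^ m] in [zeta X e^(beta X)]. *)
Definition em_rhs (zeta : C) (beta : R) (m : nat) : C :=
  if m is m'.+1 then zeta * (beta%:C%C ^+ m' / m'`!%:R) else 0.

(* [k] is the sequence of coefficients of [zeta e^(beta X) X / (e^(-X) - zeta)];
   it is constructed so that [sum_q k q D^(q-1)] sends [f] to a solution [P] of
   [P (x - 1) - zeta P x = zeta f (x + beta)] up to high derivatives of [f]. *)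
Lemma em_coefficients (zeta : C) (beta : R) : exists k : nat -> C,
  (zeta != 1 -> k 0%N = 0) /\
  forall m, \sum_(q < m.+1) k q * ((-1) ^+ (m - q) / (m - q)`!%:R) - zeta * k m =
    em_rhs zeta beta m.
Proof.
have [z1|z1] := eqVneq zeta 1.
  (* For [zeta = 1] the unknown [k m] cancels from equation [m]; equation [m + 1] determines it, and
     equation 0 reads [0 = 0]. *)
  have [k Hk] := recursive_sequence C
    (fun m q => (-1) ^+ (m.+1 - q) / (m.+1 - q)`!%:R) (fun m => - em_rhs zeta beta
      m.+1).
  exists k; split => // m; rewrite big_ord_recr /= subnn expr0 fact0 divr1 mulr1 z1
    mul1r addrK.
  case: m => [|m]; first by rewrite big_ord0.
  rewrite big_ord_recr /= subSnn expr1 -[1`!]/1%N divr1 mulrN1 Hk opprD opprK z1.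
  rewrite addrCA [X in _ + X](_ : _ = 0) ?addr0 // -sumrB big1 // => q _.
  by rewrite mulrC subrr.
have z0 : 1 - zeta != 0 by rewrite subr_eq0 eq_sym.
(* Now [k m] has the nonzero coefficient [1 - zeta] in equation [m]. *)
have [k Hk] := recursive_sequence C
  (fun m q => - (1 - zeta)^-1 * ((-1) ^+ (m - q) / (m - q)`!%:R))
  (fun m => (1 - zeta)^-1 * em_rhs zeta beta m).
exists k; split => [_|m]; first by rewrite Hk big_ord0 mulr0 addr0.
rewrite big_ord_recr /= subnn expr0 fact0 divr1 mulr1 -addrA -{1}[k m]mul1r -mulrBl.
rewrite [X in _ + _ * X]Hk mulrDr mulrA mulfV // mul1r addrCA.
rewrite [X in _ + X](_ : _ = 0) ?addr0 // mulr_sumr -big_split big1 //= => q _.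
by rewrite !mulNr mulrN -[(1 - zeta)^-1 * _ * _]mulrA mulVKf // mulrC subrr.
Qed.

(* [(s - 1) ^ delta] times the factor of [x ^ (1 - s - q)] in [D^(q-1) x^(-s)]:
   multiplying by [s - 1] when [zeta = 1] makes it a polynomial for [q = 0].
   Otherwise the value at [q = 0] is a dummy, since then [k 0 = 0]. *)
Definition em_factor (delta : bool) (s : C) (q : nat) : C :=
  if delta then - fallc (s - 1) q else if q is q'.+1 then fallc s q' else 0.

Lemma fallcD (w : C) p q : fallc w (p + q) = fallc w p * fallc (w + p%:R) q.
Proof.
rewrite /fallc big_split_ord /=; congr (_ * _); apply: eq_bigr => i _.
by rewrite natrD addrA.
Qed.

(** This is [D^(q+p-1) = D^p D^(q-1)] on [x ^ (- s)]. The hypothesis excludes the dummy value of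
    [em_factor] at [q = 0]. *)
Lemma em_factorD delta s q p : delta || (0 < q)%N ->
  em_factor delta s (q + p) = em_factor delta s q * fallc (s + q%:R - 1) p.
Proof.
rewrite /em_factor; case: delta => [_|].
  by rewrite fallcD mulNr; congr (- (_ * fallc _ _)); rewrite addrAC.
case: q => // q _; rewrite addSn fallcD; congr (_ * fallc _ _).
by rewrite -natr1 addrA addrK.
Qed.

Lemma em_factor1 delta s : em_factor delta s 1 = (s - 1) ^+ delta.
Proof.
rewrite /em_factor; case: delta; last by rewrite fallc0 expr0.
by rewrite fallcS fallc0 mulr1 opprK expr1.
Qed.

Lemma cabs_fallc (w : C) p (B : R) : cabs w <= B -> cabs (fallc w p) <= (B + p%:R)
  ^+ p.
Proof.
move=> wB; rewrite cabs_prod -[X in _ ^+ X](card_ord p) -prodr_const.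
apply: ler_prod => i _; rewrite cabs_ge0 cabsN /=; apply: le_trans (cabsD _ _) _.
by rewrite cabs_nat lerD // ler_nat ltnW.
Qed.

Lemma em_factor_bounded delta q (B : R) : exists2 G : R, 0 <= G &
  forall s, cabs s <= B -> cabs (em_factor delta s q) <= G.
Proof.
have [B0|B0] := lerP 0 B; last first.
  exists 0 => // s sB; have := le_lt_trans (cabs_ge0 s) (le_lt_trans sB B0).
  by rewrite ltxx.
have G0 (D : R) p : 0 <= D -> 0 <= (D + p%:R) ^+ p.
  by move=> D0; rewrite exprn_ge0 // addr_ge0.
rewrite /em_factor; case: delta.
  exists ((B + 1 + q%:R) ^+ q); first by rewrite G0 // addr_ge0.
  move=> s sB; rewrite cabsN; apply: cabs_fallc.
  by apply: le_trans (cabsB _ _) _; rewrite cabs1 lerD2r.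
case: q => [|q]; first by exists 0 => // s _; rewrite cabs0.
by exists ((B + q%:R) ^+ q) => [|s sB]; [exact: G0 | exact: cabs_fallc].
Qed.

(** The power [x ^ (- w)], with the sign of Dirichlet series. *)
Definition ipow (x : R) (w : C) : C := cexp (- w * (ln x)%:C%C).

Lemma cpowerV x w : (cpower x w)^-1 = ipow x w.
Proof. by rewrite /ipow mulNr cexpN. Qed.

Lemma ipowD x v w : ipow x (v + w) = ipow x v * ipow x w.
Proof. by rewrite /ipow opprD mulrDl cexpD. Qed.

Lemma cabs_ipow x w : cabs (ipow x w) = rpow x (- complex.Re w).
Proof.
rewrite cabs_cexp; congr expR; case: w => a b /=.
by rewrite mulr0 subr0.
Qed.

Lemma ipow_real x (t : R) : ipow x (t%:C%C) = (rpow x (- t))%:C%C.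
Proof.
by rewrite /ipow -rmorphN -rmorphM /cexp /= cos0 sin0 mulr1 mulr0.
Qed.

Lemma ipow_nat x p : 0 < x -> ipow x p%:R = (x%:C%C ^+ p)^-1.
Proof.
move=> x0; rewrite -(rmorph_nat (real_complex R)) ipow_real rpowN fmorphV -rmorphXn
  /=.
by rewrite /rpow expRM_natl lnK ?posrE.
Qed.

Lemma rpow_nat (x : R) p : 0 < x -> rpow x p%:R = x ^+ p.
Proof. by move=> x0; rewrite /rpow expRM_natl lnK ?posrE. Qed.

(** The binomial expansion at [u = b / x], where [2 <= x] and [|b| <= 1] ensure [|u| <= 1/2]. *)
Lemma ipow_taylor m (B : R) : exists2 T : R, 0 <= T &
  forall (x b : R) (w : C), 2 <= x -> `|b| <= 1 -> cabs w <= B ->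
  cabs (ipow (x + b) w
    - \sum_(p < m) fallc w p / p`!%:R * b%:C%C ^+ p * ipow x (w + p%:R))
  <= T * rpow x (- complex.Re w - m%:R).
Proof.
have [B0|B0] := lerP 0 B; last first.
  exists 0 => // x b w _ _ wB; have := le_lt_trans (cabs_ge0 w) (le_lt_trans wB B0).
  by rewrite ltxx.
exists ((2 * (B + m%:R)) ^+ m * expR ((B + m%:R) * ln 2)).
  by rewrite mulr_ge0 ?expR_ge0 // exprn_ge0 // mulr_ge0 // addr_ge0.
move=> x b w x2 b1 wB; have x0 : 0 < x by lra.
have u2 : `|b / x| <= 1 / 2.
  by rewrite normrM normfV (gtr0_norm x0) ler_pdivrMr //; lra.
have u1 : 0 < 1 + b / x by move: u2; rewrite ler_norml => /andP[]; lra.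
have := @binomial_remainder R m (b / x) B w u2 wB 1; rewrite ler01 lexx => /(_ isT).
rewrite !mul1r => h.
rewrite [X in cabs X](_ : _ = ipow x w * (cexp (- w * (ln (1 + b / x))%:C%C) -
    \sum_(p < m) fallc w p / p`!%:R * (b / x)%:C%C ^+ p)); last first.
  rewrite mulrBr; congr (_ - _).
    rewrite /ipow -cexpD -mulrDr -rmorphD /= -lnM ?posrE //.
    by rewrite mulrDr mulr1 mulrCA mulfV ?mulr1 // gt_eqF.
  rewrite mulr_sumr; apply: eq_bigr => p _.
  rewrite ipowD ipow_nat // rmorphM /= exprMn fmorphV exprVn; ring.
rewrite cabsM cabs_ipow mulrC rpowD.
apply: (@le_trans _ _ ((2 * (B + m%:R)) ^+ m * expR ((B + m%:R) * ln 2) *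
    `|b / x| ^+ m * rpow x (- complex.Re w))).
  by apply: ler_wpM2r => //; exact: rpow_ge0.
rewrite -mulrA; apply: ler_wpM2l.
  by rewrite mulr_ge0 ?expR_ge0 // exprn_ge0 // mulr_ge0 // addr_ge0.
rewrite mulrC; apply: ler_wpM2l; first exact: rpow_ge0.
rewrite rpowN rpow_nat // normrM exprMn normfV (gtr0_norm x0) exprVn.
by rewrite ger_pMl ?invr_gt0 ?exprn_gt0 // exprn_ile1.
Qed.

Lemma triangle_sum (V : nmodType) (G : nat -> nat -> V) N :
  \sum_(q < N) \sum_(p < N - q) G q p = \sum_(m < N) \sum_(q < m.+1) G q (m - q)%N.
Proof.
elim: N => [|N IH]; first by rewrite !big_ord0.
rewrite big_ord_recr [RHS]big_ord_recr /= -IH subSnn big_ord1.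
rewrite [X in _ + X = _](_ : _ = G N (N - N)%N) ?subnn //.
rewrite [in RHS]big_ord_recr /= subnn addrA -big_split; congr (_ + _).
by apply: eq_bigr => q _; rewrite subSn 1?ltnW // big_ord_recr.
Qed.

(** [(s - 1)^delta] times the defect [zeta f (x + beta) - (P (x - 1) - zeta P x)] of the difference
    equation, for [f x = x ^ (- s)] and [P] truncated after [N] terms. *)
Definition em_error (zeta : C) (beta : R) (k : nat -> C) (delta : bool) N (x : R) (s
  : C) :=
  em_factor delta s 1 * zeta * ipow (x + beta) s
  - \sum_(q < N) k q * em_factor delta s q *
      (ipow (x - 1) (s + q%:R - 1) - zeta * ipow x (s + q%:R - 1)).

(** All powers are expanded around [x] up to the same total order: [N.-1] terms for [x + beta], and
    [N - q] terms for the [q]-th power of [x - 1], whose exponent already contains [q]. The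
    coefficients of [x ^ (1 - s - m)] with [m < N] cancel by the equations for [k], and the Taylor
    remainders survive. *)
Lemma em_error_bound (zeta : C) (beta : R) (k : nat -> C) (delta : bool) N (B : R) :
  cabs zeta = 1 -> `|beta| <= 1 -> (~~ delta -> k 0%N = 0) ->
  (forall m, \sum_(q < m.+1) k q * ((-1) ^+ (m - q) / (m - q)`!%:R) - zeta * k m =
    em_rhs zeta beta m) ->
  exists2 T : R, 0 <= T & forall (x : R) (s : C), 2 <= x -> cabs s <= B ->
    cabs (em_error zeta beta k delta N x s) <= T * rpow x (- complex.Re s - N.-1%:R).
Proof.
move=> z1 b1 k0 kE.
have [T T0 HT] := ipow_taylor N.-1 B.
have [G G0 HG] := em_factor_bounded delta 1 B.
have /choice[Gq HGq] q : exists G : R, 0 <= G /\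
    forall s, cabs s <= B -> cabs (em_factor delta s q) <= G.
  by have [g g0 hg] := em_factor_bounded delta q B; exists g.
have /choice[Tq HTq] (q : nat) : exists T : R, 0 <= T /\
    forall (x b : R) (w : C), 2 <= x -> `|b| <= 1 -> cabs w <= B + q%:R + 1 ->
    cabs (ipow (x + b) w
      - \sum_(p < N - q) fallc w p / p`!%:R * b%:C%C ^+ p * ipow x (w + p%:R))
    <= T * rpow x (- complex.Re w - (N - q)%:R).
  by have [t t0 ht] := ipow_taylor (N - q) (B + q%:R + 1); exists t.
exists (G * T + \sum_(q < N) cabs (k q) * Gq q * Tq q).
  rewrite addr_ge0 ?mulr_ge0 // sumr_ge0 // => q _.
  by rewrite !mulr_ge0 ?cabs_ge0 ?(HGq q).1 ?(HTq q).1.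
move=> x s x2 sB.
pose S1 := \sum_(p < N.-1) fallc s p / p`!%:R * beta%:C%C ^+ p * ipow x (s + p%:R).
pose S2 (q : nat) := \sum_(p < N - q) fallc (s + q%:R - 1) p / p`!%:R *
  (-1)%:C%C ^+ p * ipow x (s + q%:R - 1 + p%:R).
have main : em_factor delta s 1 * zeta * S1 =
    \sum_(q < N) k q * em_factor delta s q * (S2 q - zeta * ipow x (s + q%:R - 1)).
  (* The case excluded from [em_factorD] is absorbed by [k 0 = 0]. *)
  have facD q p : k q * em_factor delta s q * fallc (s + q%:R - 1) p =
      k q * em_factor delta s (q + p).
    have [dq|] := boolP (delta || (0 < q)%N); first by rewrite em_factorD // mulrA.
    rewrite negb_or -leqNgt leqn0 => /andP[/k0 k00 /eqP ->].
    by rewrite k00 !mul0r.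
  transitivity (\sum_(m < N) em_factor delta s m * em_rhs zeta beta m *
      ipow x (s + m%:R - 1)).
    rewrite /S1 /em_rhs; case: (N) => [|N']; first by rewrite !big_ord0 mulr0.
    rewrite big_ord_recl /= mulr0 mul0r add0r mulr_sumr; apply: eq_bigr => p _.
    have e1 : em_factor delta s p.+1 = em_factor delta s 1 * fallc s p.
      by rewrite -add1n em_factorD ?orbT // mulr1n addrK.
    rewrite /bump /= add1n e1 -natr1 addrA addrK; ring.
  transitivity (\sum_(m < N) (\sum_(q < m.+1) k q * em_factor delta s m *
      ((-1) ^+ (m - q) / (m - q)`!%:R) * ipow x (s + m%:R - 1)
      - k m * em_factor delta s m * (zeta * ipow x (s + m%:R - 1)))).
    apply: eq_bigr => m _; rewrite -kE; under [in RHS]eq_bigr do rewrite -mulrA.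
    rewrite mulrBr mulrBl mulr_sumr mulr_suml; congr (_ - _); last by ring.
    by apply: eq_bigr => q _; ring.
  under [RHS]eq_bigr do rewrite mulrBr.
  rewrite !sumrB; congr (_ - _).
  pose G' (q p : nat) : C := k q * em_factor delta s (q + p) *
      ((-1) ^+ p / p`!%:R) * ipow x (s + (q + p)%:R - 1).
  transitivity (\sum_(m < N) \sum_(q < m.+1) G' q (m - q)%N).
    apply: eq_bigr => m _; apply: eq_bigr => q _.
    by rewrite /G' subnKC // -ltnS.
  rewrite -triangle_sum; apply: eq_bigr => q _; rewrite mulr_sumr.
  apply: eq_bigr => p _; rewrite /G' -facD natrD rmorphN1.
  have -> : s + (q%:R + p%:R) - 1 = s + q%:R - 1 + p%:R by ring.
  by ring.
have -> : em_error zeta beta k delta N x s =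
    em_factor delta s 1 * zeta * (ipow (x + beta) s - S1)
    - \sum_(q < N) k q * em_factor delta s q * (ipow (x - 1) (s + q%:R - 1) - S2 q).
  rewrite /em_error [in RHS]mulrBr main -addrA -opprD -big_split /=; congr (_ - _).
  by apply: eq_bigr => q _; ring.
rewrite mulrDl; apply: le_trans (cabsB _ _) _; apply: lerD.
  rewrite !cabsM z1 mulr1 -mulrA; apply: ler_pM; rewrite ?cabs_ge0 ?HG //.
  exact: HT.
apply: le_trans (cabs_sum _ _ _ _) _; rewrite mulr_suml; apply: ler_sum => q _.
rewrite !cabsM -!mulrA; apply: ler_wpM2l; first exact: cabs_ge0.
apply: ler_pM; rewrite ?cabs_ge0 ?(HGq q).2 //.
apply: le_trans ((HTq q).2 x (-1) _ x2 _ _) _.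
- by rewrite normrN1.
- apply: le_trans (cabsB _ _) _; rewrite cabs1 lerD2r.
  by apply: le_trans (cabsD _ _) _; rewrite cabs_nat lerD2r.
- apply: ler_wpM2l; first exact: (HTq q).1.
  rewrite le_eqVlt; apply/orP; left; apply/eqP; congr rpow.
  rewrite !raddfD /= natrB ?(ltnW (ltn_ord q)) // -(rmorph_nat (real_complex R)) /=.
  case: N q {HTq HT S1 S2 main} => [[]//|N q]; rewrite -natr1 /=; ring.
Qed.
End EulerMaclaurinCoefficients.

(** * Abel summation and the remainder series *)

Section Summation.

Definition twist (T : pzSemiRingType) (u : nat -> T) (a : nat -> nat -> T) (l n :
  nat) : T :=
  if l is l'.+1 then a l n else u n * a 0%N n.

(** From [n] to [n + 1] the nested sum gains its terms with outermost index [n + 1]; they collect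
    the weight [u n.+1], which [twist] records. In depth zero the nested sum is constantly 1 and the
    left-hand side telescopes to [u 0 - u K]. *)
Lemma abel_summation (T : comNzRingType) r (u : nat -> T) (a : nat -> nat -> T) K :
  (r = 0%N -> u 0%N = 1) ->
  \sum_(n < K) (u n - u n.+1) * nsum T r a n =
  nsum T r (twist T u a) K - u K * nsum T r a K.
Proof.
case: r => [|r] u0.
  under eq_bigr do rewrite /= mulr1; rewrite /= mulr1 -u0 //.
  elim: K => [|K IH]; first by rewrite big_ord0 subrr.
  by rewrite big_ord_recr /= IH addrA subrK.
elim: K => [|K IH]; first by rewrite /= !big_ord0 mulr0 subrr.
rewrite big_ord_recr {}IH /= [in RHS]big_ord_recr [in RHS]big_ord_recr /=.
set A := \sum_(_ < _) _; set B := \sum_(_ < _) _.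
set D := nsum T r _ K; ring.
Qed.

Context {R : realType}.
Local Notation C := R[i].
Implicit Types (lam alp : nat -> R) (s : nat -> C).

Definition lweight lam alp s (l n : nat) : C :=
  unit_exp (lam l) ^+ n * ipow (n%:R + alp l) (s l).

Definition merge_head (V : nmodType) (x : nat -> V) (l : nat) : V :=
  if l is l'.+1 then x l.+1 else x 0%N + x 1%N.

Definition shift_head s (q : nat) (l : nat) : C :=
  if l is l'.+1 then s l.+1 else s 0%N + s 1%N + q%:R - 1.

(* The powers are taken at [n + alpha_2], so that they combine with the second
   factor of the series; in depth one, any base that is positive at [n = 0] and
   makes the value of the powers there equal to [1] will do. *)
Definition base_next r alp : R := if r is 0%N then 1 else alp 1%N.

Definition head_power r lam alp s q n : C :=
  unit_exp (lam 0%N) ^+ n * ipow (n%:R + base_next r alp) (s 0%N + q%:R - 1).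

Lemma twist_lweight r lam alp s q K :
  nsum C r (twist C (head_power r lam alp s q) (fun l => lweight lam alp s l.+1)) K =
  nsum C r (lweight (merge_head R lam) (fun l => alp l.+1) (shift_head s q)) K.
Proof.
case: r => [//|r]; apply: nsum_ext => -[|l] n _ //=.
rewrite /head_power /lweight /= unit_expD exprMn mulrACA -ipowD.
by congr (_ * ipow _ _); ring.
Qed.

Section OneStep.
Variables (r : nat) (lam alp : nat -> R) (k : nat -> C) (delta : bool).
Hypothesis alp01 : forall l, 0 <= alp l < 1.
Hypothesis k0 : ~~ delta -> k 0%N = 0.
Hypothesis kE : forall m,
  \sum_(q < m.+1) k q * ((-1) ^+ (m - q) / (m - q)`!%:R) - unit_exp (lam 0%N) * k m =
  em_rhs (unit_exp (lam 0%N)) (alp 0%N - base_next r alp) m.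

(** The summand of [R_N] at [n_1 = n + 1], times [(s_1 - 1)^delta]; the last factor of [zeta ^+ n_1]
    sits inside [em_error]. *)
Definition rem_term N s (n : nat) : C :=
  unit_exp (lam 0%N) ^+ n *
  em_error (unit_exp (lam 0%N)) (alp 0%N - base_next r alp) k delta N
    (n.+1%:R + base_next r alp) (s 0%N) *
  nsum C r (fun l => lweight lam alp s l.+1) n.

(** The factor [zeta ^+ n] in front turns [P (x - 1) - zeta P x] into a difference of consecutive
    values, ready for Abel summation. *)
Lemma rem_termS N s n :
  rem_term N s n - rem_term N.+1 s n =
  k N * em_factor delta (s 0%N) N *
    ((head_power r lam alp s N n - head_power r lam alp s N n.+1) *
      nsum C r (fun l => lweight lam alp s l.+1) n).
Proof.
rewrite /rem_term /em_error big_ord_recr /= /head_power exprS.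
have -> : n.+1%:R + base_next r alp - 1 = n%:R + base_next r alp.
  by rewrite -natr1; ring.
set S := \sum_(_ < _) _; ring.
Qed.

Lemma sum_rem_termS N s K :
  \sum_(n < K) rem_term N s n - \sum_(n < K) rem_term N.+1 s n =
  k N * em_factor delta (s 0%N) N *
  (nsum C r (lweight (merge_head R lam) (fun l => alp l.+1) (shift_head s N)) K
   - head_power r lam alp s N K * nsum C r (fun l => lweight lam alp s l.+1) K).
Proof.
rewrite -sumrB; under eq_bigr do rewrite rem_termS.
rewrite -mulr_sumr abel_summation ?twist_lweight // => r0.
by rewrite /head_power /base_next r0 expr0 mul1r add0r /ipow ln1 mulr0 cexp0.
Qed.

Lemma sum_rem_term0 s K :
  \sum_(n < K) rem_term 0 s n =
  em_factor delta (s 0%N) 1 * nsum C r.+1 (lweight lam alp s) K.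
Proof.
rewrite nsumS mulr_sumr; apply: eq_bigr => n _.
rewrite /rem_term /em_error big_ord0 subr0 -addrA subrKC [lweight _ _ _ 0%N
  _]/lweight exprSr.
by ring.
Qed.

Lemma base_next_bound : 0 <= base_next r alp <= 1.
Proof.
rewrite /base_next; case: (r) => [|_]; first by rewrite ler01 lexx.
by have /andP[-> /ltW] := alp01 1%N.
Qed.

(** [ln (n + 1 + x)] exceeds [ln (n + 1)] by at most [ln 2]; the absolute value allows either sign
    of [t']. *)
Lemma rpow_shift (n : nat) (x t t' : R) : 0 <= x <= 1 -> t' <= t ->
  rpow (n.+1%:R + x) (- t) <= expR (`|t'| * ln 2) * rpow n.+1%:R (- t').
Proof.
move=> /andP[x0 x1] tt; have n1 : 1 <= (n.+1%:R : R) by rewrite ler1n.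
have n0 : 0 < (n.+1%:R : R) by rewrite ltr0Sn.
have y0 : 0 < n.+1%:R + x by lra.
rewrite /rpow -expRD ler_expR.
have l1 : 0 <= ln (n.+1%:R + x) by rewrite ln_ge0; lra.
apply: (@le_trans _ _ (- t' * ln (n.+1%:R + x))).
  by rewrite ler_wpM2r // lerN2.
have d1 : 0 <= ln (n.+1%:R + x) - ln n.+1%:R.
  by rewrite subr_ge0 ler_ln ?posrE //; lra.
have d2 : ln (n.+1%:R + x) - ln n.+1%:R <= ln 2.
  by rewrite lerBlDr -lnM ?posrE // ler_ln ?posrE ?mulr_gt0 //; lra.
have -> : - t' * ln (n.+1%:R + x) =
  - t' * (ln (n.+1%:R + x) - ln n.+1%:R) + - t' * ln n.+1%:R by ring.
rewrite lerD2r; apply: le_trans (ler_norm _) _.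
by rewrite normrM normrN (ger0_norm d1) ler_wpM2l.
Qed.

Lemma cabs_lweight s (tau : nat -> R) l n : tau l <= complex.Re (s l) ->
  cabs (lweight lam alp s l n.+1) <=
    majorant (fun l => expR (`|tau l| * ln 2)) tau l n.+1.
Proof.
move=> ts; rewrite cabsM cabsX cabs_unit_exp expr1n mul1r cabs_ipow.
by apply: rpow_shift => //; have /andP[-> /ltW] := alp01 l.
Qed.

(** The error bound improves the first exponent by [N.-1], so [nsum_summable] applies to
    [tau_0 + N.-1, tau_1, ...]. Since [M] is chosen before [s], the lemma serves both convergence at
    a point and uniform convergence on balls. *)
Lemma rem_term_bound N (tau : nat -> R) (B : R) :
  (forall i, (1 <= i <= r.+1)%N -> i%:R < N.-1%:R + \sum_(l < i) tau l) ->
  exists2 M : nat -> R, (exists B', forall n, \sum_(j < n) M j <= B') &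
    forall s, (forall l, (l <= r)%N -> tau l <= complex.Re (s l)) ->
      cabs (s 0%N) <= B -> forall n, cabs (rem_term N s n) <= M n.
Proof.
move=> ht.
have b1 : `|alp 0%N - base_next r alp| <= 1.
  have /andP[a0 a1] := alp01 0%N; have /andP[c0 c1] := base_next_bound.
  by rewrite ler_norml; apply/andP; split; lra.
have [T T0 HT] := em_error_bound (unit_exp (lam 0%N)) (alp 0%N - base_next r alp)
  k delta N B (cabs_unit_exp _) b1 k0 kE.
pose tau' l := if l is l'.+1 then tau l else tau 0%N + N.-1%:R.
pose c (l : nat) : R := if l is l'.+1 then expR (`|tau l| * ln 2)
  else T * expR (`|tau 0%N + N.-1%:R| * ln 2).
have c0 l : 0 <= c l by case: l => [|l] /=; rewrite ?mulr_ge0 ?expR_ge0.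
have [|B' HB'] := nsum_summable r.+1 c tau' c0.
  move=> i ir; apply: lt_le_trans (ht i ir) _.
  case: i ir => [//|i] _; rewrite !big_ord_recl /=.
  by rewrite addrCA addrA.
exists (fun n => c 0%N * rpow n.+1%:R (- tau' 0%N) *
    nsum R r (fun l => majorant c tau' l.+1) n); first by exists B'.
move=> s sr sB n; rewrite /rem_term !cabsM cabsX cabs_unit_exp expr1n mul1r.
have hn : cabs (nsum C r (fun l => lweight lam alp s l.+1) n) <=
    nsum R r (fun l => majorant c tau' l.+1) n.
  apply: cabs_nsum => l n' lr; exact: (cabs_lweight s tau l.+1 n' (sr l.+1 lr)).
have /andP[bn0 bn1] := base_next_bound.
(* [em_error_bound] requires [2 <= x], which fails only for [n = 0] and [r > 0], where the inner sum
   is empty. *)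
have [x2|x2] := lerP 2 (n.+1%:R + base_next r alp); last first.
  have [r0 n0] : r <> 0%N /\ n = 0%N.
    split; first by move=> r0; move: x2; rewrite /base_next r0 -natr1;
      have := ler0n R n; lra.
    case: n {hn} x2 => [//|n] x2; have : 2%:R <= (n.+2%:R : R) by rewrite ler_nat.
    by move=> h; have := lt_le_trans x2 h; rewrite ltNge lerDl bn0.
  rewrite n0; case: (r) r0 => [//|r' _] /=; rewrite !big_ord0 cabs0 !mulr0.
  by [].
apply: ler_pM; rewrite ?cabs_ge0 //.
apply: le_trans (HT _ _ x2 sB) _; rewrite -mulrA; apply: ler_wpM2l => //.
have -> : - complex.Re (s 0%N) - N.-1%:R = - (complex.Re (s 0%N) + N.-1%:R) by ring.
apply: rpow_shift; first by rewrite bn0 bn1.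
by rewrite lerD2r sr.
Qed.

Lemma head_power_decay s q :
  0 < complex.Re (s 0%N) + q%:R - 1 ->
  (forall i, (1 <= i <= r)%N ->
    i%:R < complex.Re (s 0%N) + q%:R - 1 + \sum_(l < i) complex.Re (s l.+1)) ->
  ccvg (fun K => head_power r lam alp s q K *
    nsum C r (fun l => lweight lam alp s l.+1) K) 0.
Proof.
move=> s0 hs e e0.
pose sg := complex.Re (s 0%N) + q%:R - 1.
pose c (l : nat) : R := expR (`|complex.Re (s l.+1)| * ln 2).
have c0 l : 0 <= c l by exact: expR_ge0.
have [N HN] := nsum_decay r c (fun l => complex.Re (s l.+1)) sg c0 s0 hs
  (expR (`|sg| * ln 2)) e (expR_ge0 _) e0.
exists N.+1 => -[//|n] Nn; rewrite subr0; apply: le_trans (HN _ (ltnW Nn)).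
rewrite cabsM; apply: ler_pM; rewrite ?cabs_ge0 //.
  rewrite /head_power cabsM cabsX cabs_unit_exp expr1n mul1r cabs_ipow.
  have -> : complex.Re (s 0%N + q%:R - 1) = sg.
    by rewrite raddfB raddfD -(rmorph_nat (real_complex R)).
  by apply: rpow_shift => //; exact: base_next_bound.
apply: cabs_nsum => l n' _.
exact: (cabs_lweight s (fun l => complex.Re (s l)) l.+1 n').
Qed.

End OneStep.
End Summation.

(** * Functions with simple poles along hyperplanes *)

Lemma near_eq_differentiable (K : numFieldType) (V W : normedModType K)
    (f g : V -> W) (t : V) :
  (\forall u \near t, f u = g u) -> differentiable f t -> differentiable g t.
Proof.
move=> fg fd; apply: (differentiable_epsilon _ _ _ g ('d f t)).
  exact: diff_continuous.
move=> e e0; have := diff_locally fd => /eqaddoP /(_ e e0) fo.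
have fg0 : \forall h \near (0 : V), f (t + h) = g (t + h).
  have := fg; rewrite (near_shift 0) /= subr0; apply: filterS => h.
  by rewrite /= addrC.
have ft := nbhs_singleton fg.
apply: filterS2 fo fg0 => h /= h1 h2; rewrite -h2 -ft.
by move: h1; rewrite !fctE /= opprD addrA [h + t]addrC.
Qed.

Section LocalPoles.
Context {R : realType} {r : nat}.
Local Notation C := R[i].
Implicit Types (s t : 'rV[C]_r) (f g F G : 'rV[C]_r -> C^o) (A : set (nat * nat)).

Lemma holomorphic_ext f g s : (\forall t \near s, f t = g t) ->
  holomorphic_at f s -> holomorphic_at g s.
Proof.
move=> /near_join fg; apply: filterS2 fg => t fgt.
exact: near_eq_differentiable.
Qed.

Lemma holomorphic_cst (c : C) s : holomorphic_at (fun=> c : C^o) s.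
Proof. by near=> t; exact: differentiable_cst. Unshelve. all: by end_near. Qed.

Lemma holomorphicD f g s : holomorphic_at f s -> holomorphic_at g s ->
  holomorphic_at (fun t => f t + g t) s.
Proof. by apply: filterS2 => t df dg; exact: differentiableD. Qed.

Lemma holomorphicM f g s : holomorphic_at f s -> holomorphic_at g s ->
  holomorphic_at (fun t => f t * g t : C^o) s.
Proof. by apply: filterS2 => t df dg; exact: differentiableM. Qed.

Lemma holomorphic_prod (I : Type) (q : seq I) (f : I -> 'rV[C]_r -> C^o) s :
  (forall i, holomorphic_at (f i) s) ->
  holomorphic_at (fun t => \prod_(i <- q) f i t : C^o) s.
Proof.
move=> fh; elim: q => [|i q IH].
  by under eq_fun do rewrite big_nil; exact: holomorphic_cst.
by under eq_fun do rewrite big_cons; exact: holomorphicM.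
Qed.

Lemma holomorphic_neq0 f s : holomorphic_at f s -> f s != 0 ->
  \forall t \near s, f t != 0.
Proof.
move=> fh fs; have fc := differentiable_continuous (nbhs_singleton fh).
exact: (cvgr_neq0 _ fc fs).
Qed.

Lemma holomorphicV f s : holomorphic_at f s -> f s != 0 ->
  holomorphic_at (fun t => (f t)^-1 : C^o) s.
Proof.
move=> fh fs; have f0 := holomorphic_neq0 _ _ fh fs.
by apply: filterS2 fh f0 => t df ft; exact: differentiableV.
Qed.

Lemma hyperplane_eqn_polyfun p : polyfun (@hyperplane_eqn R[i] r p : _ -> C).
Proof.
rewrite /hyperplane_eqn /psum; apply: polyfunD; last exact: polyfun_cst.
suff h (q : seq 'I_r) : polyfun (fun t : 'rV[C]_r => \sum_(l <- q | (l < p.1)%N) t 0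
  l).
  exact: h.
elim: q => [|l q IH].
  by under eq_fun do rewrite big_nil; exact: polyfun_cst.
have [lp|/negbTE lp] := boolP (l < p.1)%N; under eq_fun do rewrite big_cons lp.
  by apply: polyfunD => //; exact: polyfun_coord.
exact: IH.
Qed.

Lemma polyfun_holomorphic (f : 'rV[C]_r -> C) s : polyfun f ->
  holomorphic_at (f : _ -> C^o) s.
Proof.
by move=> fp; apply: (polylim_holomorphic s 1) => //; exact: polylim_poly.
Qed.

Lemma hyperplane_eqn_holomorphic p s : holomorphic_at (@hyperplane_eqn R[i] r p) s.
Proof. exact: polyfun_holomorphic (hyperplane_eqn_polyfun p). Qed.

(** Local form of [possible_simple_poles]. The identity is asked wherever the chosen product is
    nonzero, a condition that does not mention [A]; this makes the notion monotone in [A] and gives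
    a local quotient for meromorphy at once. *)
Definition poles_at A F s := exists (ps : seq (nat * nat)) G,
  [/\ uniq ps, (forall p, p \in ps -> A p), holomorphic_at G s &
      \forall t \near s, \prod_(p <- ps) hyperplane_eqn p t != 0 :> C ->
        \prod_(p <- ps) hyperplane_eqn p t * F t = G t].

Lemma poles_at_holomorphic A F s : holomorphic_at F s -> poles_at A F s.
Proof.
move=> Fh; exists [::], F; split => //.
by near=> t; rewrite big_nil mul1r.
Unshelve. all: by end_near. Qed.

Lemma poles_at_sub A A' F s : A' `<=` A -> poles_at A' F s -> poles_at A F s.
Proof. by move=> A'A [ps [G [? psA ? ?]]]; exists ps, G; split => // p /psA/A'A. Qed.

Lemma poles_at_ext A F G s : (\forall t \near s, F t = G t) ->
  poles_at A F s -> poles_at A G s.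
Proof.
move=> FG [ps [H [ups psA Hh FH]]]; exists ps, H; split => //.
by apply: filterS2 FG FH => t <-.
Qed.

Lemma poles_atM A f F s : holomorphic_at f s -> poles_at A F s ->
  poles_at A (fun t => f t * F t : C^o) s.
Proof.
move=> fh [ps [H [ups psA Hh FH]]]; exists ps, (fun t => f t * H t : C^o);
  split => //.
  exact: holomorphicM.
by apply: filterS FH => t h /h <-; rewrite mulrCA.
Qed.

(** The common denominator runs over the union of the two lists without repetition, so each
    hyperplane still occurs once. *)
Lemma poles_atD A F F' s : poles_at A F s -> poles_at A F' s ->
  poles_at A (fun t => F t + F' t) s.
Proof.
move=> [ps [G [ups psA Gh FG]]] [qs [G' [uqs qsA Gh' FG']]].
pose ps' := [seq p <- ps | p \notin qs]; pose qs' := [seq q <- qs | q \notin ps].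
have uni (a b : seq (nat * nat)) : uniq a -> uniq b ->
    uniq (a ++ [seq q <- b | q \notin a]).
  move=> ua ub; rewrite cat_uniq ua filter_uniq // andbT /=.
  by apply/hasPn => x; rewrite mem_filter => /andP[].
have memcat (a b : seq (nat * nat)) x :
    (x \in a ++ [seq q <- b | q \notin a]) = (x \in a) || (x \in b).
  by rewrite mem_cat mem_filter; case: (x \in a).
have pq : perm_eq (ps ++ qs') (qs ++ ps').
  by apply: uniq_perm; rewrite ?uni // => x; rewrite !memcat orbC.
have e1 t : \prod_(p <- ps ++ qs') hyperplane_eqn p t =
    \prod_(p <- ps) hyperplane_eqn p t * \prod_(p <- qs') hyperplane_eqn p t :> C.
  exact: big_cat.
have e2 t : \prod_(p <- ps ++ qs') hyperplane_eqn p t =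
    \prod_(p <- qs) hyperplane_eqn p t * \prod_(p <- ps') hyperplane_eqn p t :> C.
  by rewrite (perm_big _ pq) /=; exact: big_cat.
exists (ps ++ qs'), (fun t => \prod_(p <- qs') hyperplane_eqn p t * G t +
  \prod_(p <- ps') hyperplane_eqn p t * G' t : C^o); split.
- exact: uni.
- by move=> p; rewrite memcat => /orP[/psA|/qsA].
- apply: holomorphicD; apply: holomorphicM => //; apply: holomorphic_prod => p;
  exact: hyperplane_eqn_holomorphic.
- apply: filterS2 FG FG' => t h h' nz; rewrite mulrDr; congr (_ + _).
    move: nz; rewrite e1 mulf_eq0 negb_or => /andP[/h <- _].
    by rewrite mulrAC mulrC.
  move: nz; rewrite e2 mulf_eq0 negb_or => /andP[/h' <- _].
  by rewrite mulrAC mulrC.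
Qed.

Lemma poles_at_sum A (I : Type) (q : seq I) (F : I -> 'rV[C]_r -> C^o) s :
  (forall i, poles_at A (F i) s) -> poles_at A (fun t => \sum_(i <- q) F i t) s.
Proof.
move=> Fp; elim: q => [|i q IH].
  under eq_fun do rewrite big_nil.
  by apply: poles_at_holomorphic; exact: holomorphic_cst.
by under eq_fun do rewrite big_cons; exact: poles_atD.
Qed.

(** [~ A' p] keeps the new equation from repeating one in the denominator, so the pole is simple. *)
Lemma poles_at_div A A' p F s : A' `<=` A -> A p -> ~ A' p -> poles_at A' F s ->
  poles_at A (fun t => F t / hyperplane_eqn p t : C^o) s.
Proof.
move=> A'A Ap A'p [ps [G [ups psA Gh FG]]]; exists (p :: ps), G; split => //.
- by rewrite /= ups andbT; apply/negP => /psA.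
- by move=> q; rewrite inE => /orP[/eqP -> //|/psA/A'A].
- apply: filterS FG => t h; rewrite big_cons mulf_eq0 negb_or => /andP[p0 /h <-].
  rewrite [X in X * _ = _]mulrC -mulrA; congr (_ * _).
  by rewrite mulrCA mulfV // mulr1.
Qed.

Lemma poles_at_possible A F : (forall s, poles_at A F s) -> possible_simple_poles A F.
Proof.
move=> Fp; split => s.
  move=> sA; have [ps [G [ups psA Gh FG]]] := Fp s.
  have h0 : \prod_(p <- ps) hyperplane_eqn p s != 0 :> C.
    rewrite prodf_seq_neq0; apply/allP => p pps /=; rewrite subr_eq0.
    by apply/eqP => e; exact: (sA p (psA p pps)).
  have hh : holomorphic_at (fun t => \prod_(p <- ps) hyperplane_eqn p t : C^o) s.
    by apply: holomorphic_prod => p; exact: hyperplane_eqn_holomorphic.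
  have hV := holomorphicV _ _ hh h0.
  apply: holomorphic_ext (holomorphicM _ _ _ hV Gh).
  have nz := holomorphic_neq0 _ _ hh h0.
  by apply: filterS2 FG nz => t h n0; rewrite -h // mulKf.
have [ps [G [ups psA Gh FG]]] := Fp s; exists ps, G; split => //.
apply: filterS FG => t h tA; apply: h; rewrite prodf_seq_neq0.
apply/allP => p pps /=; rewrite subr_eq0.
by apply/eqP => e; exact: (tA p (psA p pps)).
Qed.

(** On the line through [s] in the first coordinate direction each equation is [x] plus a constant,
    because every hyperplane involves the first coordinate. The denominator restricts to a nonzero
    polynomial in [x], so it is not the zero germ. *)
Lemma poles_at_meromorphic A F : (forall p, A p -> (1 <= p.1 <= r)%N) ->
  (forall s, poles_at A F s) -> meromorphic F.
Proof.
move=> A1 Fp s; have [ps [G [ups psA Gh FG]]] := Fp s.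
exists G, (fun t => \prod_(p <- ps) hyperplane_eqn p t : C^o); split => //.
- by apply: holomorphic_prod => p; exact: hyperplane_eqn_holomorphic.
- move=> /near_norm1P[d d0 hd].
  have [ps0|[p0 p0ps]] : ps = [::] \/ exists p, p \in ps.
    by case: (ps) => [|p q]; [left | right; exists p; rewrite mem_head].
    have := hd s; rewrite subrr norm1_0 ps0 big_nil => /(_ d0)/eqP.
    by rewrite oner_eq0.
  have r0 : (0 < r)%N by have /andP[h1 h2] := A1 _ (psA _ p0ps); exact: leq_trans h2.
  pose e : 'rV[C]_r := \row_j (j == Ordinal r0)%:R.
  pose v (x : R) := s + x%:C%C *: e.
  have ve p x : p \in ps -> hyperplane_eqn p (v x) = hyperplane_eqn p s + x%:C%C :> C.
    move=> /psA/A1 /andP[p1 pr]; rewrite /hyperplane_eqn addrAC; congr (_ - _).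
    rewrite /psum (bigD1 (Ordinal r0)) //= [X in _ = X + _](bigD1 (Ordinal r0)) //=.
    rewrite !mxE eqxx mulr1 addrAC; congr (_ + _ + _).
    by apply: eq_bigr => l /andP[_ /negbTE l0]; rewrite !mxE l0 mulr0 addr0.
  pose q : {poly C} := \prod_(p <- ps) ('X + (hyperplane_eqn p s)%:P).
  have q0 : q != 0.
    by rewrite prodf_seq_neq0; apply/allP => p _ /=;
      rewrite -size_poly_eq0 size_XaddC.
  (* As many points as the size of [q], which exceeds its number of roots; [k.+2] keeps them
     strictly within distance [d]. *)
  pose xs := [seq (d / k.+2%:R : R) | k <- iota 0 (size q)].
  have uxs : uniq [seq (x%:C)%C | x <- xs].
    rewrite map_inj_uniq; last exact: complexI.
    rewrite map_inj_uniq ?iota_uniq // => k k' /(mulfI (lt0r_neq0 d0))/invr_inj/eqP.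
    by rewrite eqr_nat => /eqP[].
  have rxs : all (root q) [seq (x%:C)%C | x <- xs].
    apply/allP => _ /mapP[_ /mapP[k _ ->] ->]; rewrite rootE /q horner_prod.
    have := hd (v (d / k.+2%:R)); rewrite /v addrAC subrr add0r norm1Z cabs_real.
    have -> : norm1 e = 1.
      rewrite /norm1 (bigD1 (Ordinal r0)) //= mxE eqxx cabs1 big1 ?addr0 // => l
        /negbTE l0.
      by rewrite mxE l0 cabs0.
    rewrite mulr1 gtr0_norm ?divr_gt0 // ltr_pdivrMr ?ltr0Sn //.
    rewrite ltr_pMr // ltr1n ltnS => /(_ isT) <-; rewrite eq_sym; apply/eqP.
    rewrite big_seq [RHS]big_seq; apply: eq_bigr => p pps.
    by rewrite -/(v _) ve // hornerD hornerX hornerC addrC.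
  have := max_poly_roots q0 rxs uxs; rewrite !size_map size_iota ltnn.
  by [].
- apply: filterS FG => t h n0.
  by rewrite -h // mulrC mulKf.
Qed.

End LocalPoles.

(** * Merging the first two variables *)

Section Coordinates.

(* Coordinates indexed by all natural numbers, [0] beyond the dimension. *)
Definition coordn (V : nmodType) (r : nat) (x : 'rV[V]_r) (l : nat) : V :=
  if insub l is Some i then x 0 i else 0.

Lemma coord_ord (V : nmodType) r (x : 'rV[V]_r) (l : 'I_r) : coordn V r x l = x 0 l.
Proof. by rewrite /coordn valK. Qed.

Lemma coord_row (V : nmodType) r (f : nat -> V) l : (l < r)%N ->
  coordn V r (\row_(j < r) f j) l = f l.
Proof. by move=> lr; rewrite -[l]/(val (Ordinal lr)) coord_ord mxE. Qed.

Lemma psum_coord (V : nmodType) r (x : 'rV[V]_r) i : (i <= r)%N ->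
  psum x i = \sum_(l < i) coordn V r x l.
Proof.
move=> ir; rewrite (big_ord_widen _ (coordn V r x) ir) /psum.
by apply: eq_bigr => l _; rewrite coord_ord.
Qed.

Context {R : realType}.
Local Notation C := R[i].

Definition shift_row r (q : nat) (t : 'rV[C]_r.+1) : 'rV[C]_r :=
  \row_l shift_head (coordn C _ t) q l.

Lemma coord_shift_row r q (t : 'rV[C]_r.+1) l : (l < r)%N ->
  coordn C _ (shift_row r q t) l = shift_head (coordn C _ t) q l.
Proof. exact: coord_row. Qed.

Lemma norm1_coord r (x : 'rV[C]_r) : norm1 x = \sum_(l < r) cabs (coordn C _ x l).
Proof. by apply: eq_bigr => l _; rewrite coord_ord. Qed.

Lemma coordB r (x y : 'rV[C]_r) l : coordn C _ (x - y) l = coordn C _ x l - coordn C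
  _ y l.
Proof. by rewrite /coordn; case: insubP => [i _ _|_]; rewrite ?mxE ?subrr. Qed.

Lemma coordP r (a : C) (x y : 'rV[C]_r) l :
  coordn C _ (a *: x + y) l = a * coordn C _ x l + coordn C _ y l.
Proof. by rewrite /coordn; case: insubP => [i _ _|_]; rewrite ?mxE ?mulr0 ?addr0. Qed.

Lemma norm1_shift_row r q (t u : 'rV[C]_r.+1) :
  norm1 (shift_row r q t - shift_row r q u) <= norm1 (t - u).
Proof.
rewrite !norm1_coord; case: r t u => [|r] t u.
  by rewrite big_ord0 sumr_ge0 // => l _; exact: cabs_ge0.
rewrite big_ord_recl [leRHS]big_ord_recl [X in _ <= _ + X]big_ord_recl addrA.
rewrite !coordB !coord_shift_row //=; apply: lerD.
  rewrite (_ : _ - _ = coordn C _ t 0 - coordn C _ u 0 + (coordn C _ t 1 - coordn C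
    _ u 1)).
    exact: cabsD.
  ring.
apply: ler_sum => l _; have lr : (l.+1 < r.+1)%N := ltn_ord l.
by rewrite /bump !add1n !coordB !coord_shift_row.
Qed.

Lemma shift_row_differentiable r q (t : 'rV[C]_r.+1) :
  differentiable (shift_row r q) t.
Proof.
pose L (u : 'rV[C]_r.+1) := shift_row r q u - shift_row r q 0.
have L_lin : linear L.
  move=> a x y; apply/rowP => -[l lr]; rewrite !mxE /=.
  have c0 l' : coordn C r.+1 0 l' = 0 by rewrite /coordn; case: insubP => // i _ _;
    rewrite mxE.
  by case: l lr => [|l] _; rewrite /= !coordP !c0; ring.
pose LlM := GRing.isLinear.Build _ _ _ _ _ L_lin.
pose LL : {linear 'rV[C]_r.+1 -> 'rV[C]_r} := HB.pack L LlM.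
have Lc : continuous LL.
  apply: continuousfor0_continuous; rewrite /prop_for /continuous_at linear0 => P.
  move=> /near_norm1P[d d0 dP].
  apply/near_norm1P; exists d => // h; rewrite subr0 => hd; apply: dP.
  rewrite subr0 /= /L; apply: le_lt_trans (norm1_shift_row _ _ _ _) _.
  by rewrite subr0.
have -> : shift_row r q =
    (LL : 'rV[C]_r.+1 -> 'rV[C]_r) + (cst (shift_row r q 0) : 'rV[C]_r.+1 ->
      'rV[C]_r).
  by apply/funext => u; rewrite fctE /= /L subrK.
apply: (@differentiableD _ _ _ (LL : 'rV[C]_r.+1 -> 'rV[C]_r)).
  exact: linear_differentiable Lc.
exact: differentiable_cst.
Qed.

Lemma near_shift_row r q (s : 'rV[C]_r.+1) (P : set 'rV[C]_r) :
  (\forall u \near shift_row r q s, P u) -> \forall t \near s, P (shift_row r q t).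
Proof.
move=> /near_norm1P[d d0 dP]; apply/near_norm1P; exists d => // t ts; apply: dP.
exact: le_lt_trans (norm1_shift_row _ _ _ _) ts.
Qed.

Lemma psum_shift_row r q (t : 'rV[C]_r.+1) i : (1 <= i <= r)%N ->
  psum (shift_row r q t) i = psum t i.+1 + q%:R - 1.
Proof.
case: i => [//|i] ir; rewrite !psum_coord // !big_ord_recl /=.
rewrite coord_shift_row ?(leq_ltn_trans (leq0n i) ir) //=.
rewrite (eq_bigr (fun l : 'I_i => coordn C _ t l.+2)) => [|l _]; last first.
  by rewrite coord_shift_row ?(leq_trans (ltn_ord (lift ord0 l)) ir).
by set S := \sum_(_ < _) _; rewrite -[bump 0 0]/1%N; ring.
Qed.

Lemma hyperplane_eqn_shift_row r q (t : 'rV[C]_r.+1) p : (1 <= p.1 <= r)%N ->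
  hyperplane_eqn p (shift_row r q t) = hyperplane_eqn (p.1.+1, p.2 + q)%N t :> C.
Proof.
case: p => i k /= ir.
transitivity (psum t i.+1 + q%:R - 1 - (i%:R - k%:R) : C).
  by rewrite -psum_shift_row.
rewrite -[RHS]/(psum t i.+1 - (i.+1%:R - (k + q)%:R) : C).
by rewrite (natrD _ k q) -[i.+1%:R]natr1; set x := psum t _; ring.
Qed.

Lemma poles_at_shift_row r q (A A' : set (nat * nat)) (F : 'rV[C]_r -> C^o) s :
  (forall p, A p -> (1 <= p.1 <= r)%N) ->
  (forall p, A p -> A' (p.1.+1, p.2 + q)%N) ->
  poles_at A F (shift_row r q s) -> poles_at A' (F \o shift_row r q) s.
Proof.
move=> A1 AA' [ps [G [ups psA Gh FG]]].
pose g (p : nat * nat) := (p.1.+1, p.2 + q)%N.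
have e t : \prod_(p <- map g ps) hyperplane_eqn p t =
    \prod_(p <- ps) hyperplane_eqn p (shift_row r q t) :> C.
  rewrite big_map big_seq [RHS]big_seq; apply: eq_bigr => p /psA/A1 pr.
  by rewrite hyperplane_eqn_shift_row.
exists (map g ps), (G \o shift_row r q); split.
- rewrite map_inj_uniq // => -[a b] [c d] [-> /eqP].
  by rewrite eqn_add2r => /eqP ->.
- by move=> _ /mapP[p /psA/AA' ? ->].
- move: (near_shift_row _ _ _ _ Gh); apply: filterS => t Gd.
  by apply: differentiable_comp => //; exact: shift_row_differentiable.
- move: (near_shift_row _ _ _ _ FG); apply: filterS => t h.
  by rewrite e; exact: h.
Qed.

End Coordinates.

(** * The continuation *)

Section Continuation.
Context {R : realType}.
Local Notation C := R[i].

Definition partial_mu (lam : nat -> R) (i : nat) : R := \sum_(l < i) lam l.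

Definition int_mu_count (lam : nat -> R) (i : nat) : nat :=
  (\sum_(j < i) (partial_mu lam j.+1 \is a Num.int))%N.

(** The list of the theorem in a form suited to induction: at [i = i_j] the count is [j], so the
    third condition reads [i_j - k <= j]. The last one reflects that [s_1 - 1] is the only
    denominator in [s_1] alone. *)
Definition pole_set r (lam : nat -> R) : set (nat * nat) :=
  [set p | [/\ (1 <= p.1 <= r)%N, partial_mu lam p.1 \is a Num.int,
    (p.1 <= int_mu_count lam p.1 + p.2)%N & (p.1 = 1%N -> p.2 = 0%N)]].

Lemma partial_mu_merge (lam : nat -> R) i :
  partial_mu (merge_head R lam) i.+1 = partial_mu lam i.+2.
Proof. by rewrite /partial_mu !big_ord_recl /= addrA. Qed.

Lemma int_mu_count_merge (lam : nat -> R) i :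
  int_mu_count lam i.+1 =
    ((lam 0%N \is a Num.int) + int_mu_count (merge_head R lam) i)%N.
Proof.
rewrite /int_mu_count big_ord_recl /=; congr (_ + _)%N.
  by rewrite /partial_mu big_ord1.
by apply: eq_bigr => j _; rewrite partial_mu_merge.
Qed.

(** The count for the merged parameters omits [lam 0]; when [lam 0] is not integral and adds nothing
    to the count, [0 < q] compensates. *)
Lemma pole_set_merge r (lam : nat -> R) q p :
  (lam 0%N \isn't a Num.int -> (0 < q)%N) -> pole_set r (merge_head R lam) p ->
  pole_set r.+1 lam (p.1.+1, p.2 + q)%N.
Proof.
case: p => -[|i] k q0 [] //= ir mu le _; split => //=.
- by rewrite -partial_mu_merge.
- rewrite int_mu_count_merge -addnA; move: q0.
  by case: (lam 0%N \is a Num.int) => [_|/(_ isT) q0] /=; lia.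
Qed.

(* [in_domain 0] is the domain of absolute convergence; [in_domain N] is where
   the remainder after [N] terms converges. *)
Definition in_domain N r (t : 'rV[C]_r) := forall i, (1 <= i <= r)%N ->
  i%:R < N.-1%:R + \sum_(l < i) complex.Re (coordn C _ t l).

Lemma in_domain_mono N N' r (t : 'rV[C]_r) : (N <= N')%N ->
  in_domain N r t -> in_domain N' r t.
Proof.
move=> NN h i ir; apply: lt_le_trans (h i ir) _; rewrite lerD2r ler_nat.
by rewrite -!subn1 leq_sub2r.
Qed.

Lemma in_domain_ex r (t : 'rV[C]_r) : exists N, in_domain N r t.
Proof.
have [y Hy] : exists y : nat, \sum_(l < r) `|complex.Re (coordn C _ t l)| + r%:R <
  y%:R.
  by eexists; exact: truncnS_gt.
exists y.+1 => i /andP[_ ir] /=.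
have : - \sum_(l < i) complex.Re (coordn C _ t l) <=
    \sum_(l < r) `|complex.Re (coordn C _ t l)|.
  apply: le_trans (ler_norm _) _; rewrite normrN; apply: le_trans (ler_norm_sum _ _
    _) _.
  rewrite -(big_mkord xpredT (fun l => `|complex.Re (coordn C _ t l)|)).
  rewrite -[leRHS](big_mkord xpredT (fun l => `|complex.Re (coordn C _ t l)|)).
  by rewrite [leRHS](@big_cat_nat _ _ _ i) //= lerDl sumr_ge0.
have : (i%:R : R) <= r%:R by rewrite ler_nat.
move: Hy; move: (\sum_(l < r) _) (\sum_(l < i) _) => A B.
move: (y%:R) (r%:R) (i%:R) => y' r' i'; lra.
Qed.

(** Openness of the domain in the form the majorants need: one sequence of lower bounds for the real
    parts, valid on a whole ball. *)
Lemma in_domain_near N r (s : 'rV[C]_r) : in_domain N r s ->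
  exists2 rho : R, 0 < rho & exists2 tau : nat -> R,
    (forall i, (1 <= i <= r)%N -> i%:R < N.-1%:R + \sum_(l < i) tau l) &
    forall t : 'rV[C]_r, norm1 (t - s) < rho ->
      forall l, tau l <= complex.Re (coordn C _ t l).
Proof.
move=> sD.
have [|e e0 He] := uniform_gap
    (fun i => N.-1%:R + \sum_(l < i) complex.Re (coordn C _ s l) - i%:R) r.
  by move=> i /sD; rewrite subr_gt0.
have r1 : 0 < (r.+1%:R : R) by rewrite ltr0Sn.
pose rho := e / r.+1%:R; have rho0 : 0 < rho by rewrite divr_gt0.
exists rho => //; exists (fun l => complex.Re (coordn C _ s l) - rho).
  move=> i ir; have := He i ir; rewrite sumrB sumr_const card_ord -[rho *+
    i]mulr_natr.
  have : rho * i%:R <= e.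
    rewrite /rho -mulrA ger_pMr // mulrC ler_pdivrMr // mul1r ler_nat.
    by case/andP: ir => _ ir; exact: leqW.
  by lra.
move=> t ts l; rewrite lerBlDr -lerBlDl -raddfB -coordB.
apply: le_trans (ler_norm _) _; apply: le_trans (Re_le_cabs _) _.
apply: le_trans _ (ltW ts); rewrite -norm1N opprB /coordn.
case: insubP => [i _ _|_]; first exact: cabs_le_norm1.
by rewrite cabs0 norm1_ge0.
Qed.

(** Condition [i] for the merged exponents follows from condition [i + 1] for [t], in view of
    [N.-1 <= N]. *)
Lemma in_domain_shift_row N r (t : 'rV[C]_r.+1) : in_domain N r.+1 t ->
  in_domain 0 r (shift_row r N t).
Proof.
move=> h [//|i] ir; rewrite add0r; have := h i.+2 ir.
rewrite !big_ord_recl /= coord_shift_row ?(leq_ltn_trans (leq0n i) ir) //=.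
rewrite raddfB !raddfD -(rmorph_nat (real_complex R)) /=.
have -> : \sum_(l < i) complex.Re (coordn C r (shift_row r N t) (bump 0 l)) =
    \sum_(l < i) complex.Re (coordn C r.+1 t l.+2).
  apply: eq_bigr => l _.
  by rewrite coord_shift_row ?(leq_trans (ltn_ord (lift ord0 l)) ir).
set S := \sum_(_ < i) complex.Re (coordn C r.+1 t _).
rewrite -[bump 0 0]/1%N -[(i.+2)%:R]natr1.
have : N.-1%:R <= (N%:R : R) by rewrite ler_nat leq_pred.
by lra.
Qed.

Lemma polyfun_coordinate r l : polyfun (fun t : 'rV[C]_r => coordn C _ t l).
Proof.
rewrite /coordn; case: insubP => [i _ _|_]; first exact: polyfun_coord.
exact: polyfun_cst.
Qed.

Section Holomorphy.
Variables (r : nat) (s : 'rV[C]_r) (rho : R).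

Lemma polylimN (f : 'rV[C]_r -> C) : polylim s rho f -> polylim s rho (fun t => - f
  t).
Proof.
move=> fl; have := polylimM _ _ _ _ (polylim_cst s rho (-1)) fl.
by apply: polylim_ext => t _; rewrite mulN1r.
Qed.

Lemma polylim_fallc (f : 'rV[C]_r -> C) q : polylim s rho f ->
  polylim s rho (fun t => fallc (f t) q).
Proof.
move=> fl; apply: polylim_prod => i.
by apply: polylimN; apply: polylimD => //; exact: polylim_cst.
Qed.

Lemma polylim_em_factor delta (f : 'rV[C]_r -> C) q : polylim s rho f ->
  polylim s rho (fun t => em_factor delta (f t) q).
Proof.
move=> fl; rewrite /em_factor; case: delta.
  by apply: polylimN; apply: polylim_fallc; apply: polylimD => //; exact: polylim_cst.
by case: q => [|q]; [exact: polylim_cst | exact: polylim_fallc].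
Qed.

Lemma polylim_ipow x (f : 'rV[C]_r -> C) : polylim s rho f ->
  polylim s rho (fun t => ipow x (f t)).
Proof.
move=> fl; apply: polylim_cexp; apply: polylimM; last exact: polylim_cst.
exact: polylimN.
Qed.

Lemma polylim_em_error zeta beta k delta N x (f : 'rV[C]_r -> C) : polylim s rho f ->
  polylim s rho (fun t => em_error zeta beta k delta N x (f t)).
Proof.
move=> fl.
have fq q : polylim s rho (fun t => f t + q%:R - 1).
  apply: polylimD; last exact: polylim_cst.
  by apply: polylimD => //; exact: polylim_cst.
rewrite /em_error; apply: polylimD.
  apply: polylimM; last exact: polylim_ipow.
  by apply: polylimM; [exact: polylim_em_factor | exact: polylim_cst].
apply: polylimN; apply: polylim_sum => q; apply: polylimM.
  by apply: polylimM; [exact: polylim_cst | exact: polylim_em_factor].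
apply: polylimD; first exact: polylim_ipow.
by apply: polylimN; apply: polylimM; [exact: polylim_cst | exact: polylim_ipow].
Qed.

Lemma polylim_nsum n (a : 'rV[C]_r -> nat -> nat -> C) K :
  (forall l m, polylim s rho (fun t => a t l m)) ->
  polylim s rho (fun t => nsum C n (a t) K).
Proof.
elim: n a K => [|n IH] a K al /=; first exact: polylim_cst.
apply: polylim_sum => m; apply: polylimM; first exact: al.
exact: (IH (fun t l => a t l.+1)).
Qed.

End Holomorphy.

Lemma polylim_rem_term r lam alp k delta N n (s : 'rV[C]_r.+1) rho :
  polylim s rho (fun t => rem_term r lam alp k delta N (coordn C _ t) n).
Proof.
have cl l : polylim s rho (fun t => coordn C _ t l).
  by apply: polylim_poly; exact: polyfun_coordinate.
rewrite /rem_term; apply: polylimM.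
  by apply: polylimM; [exact: polylim_cst | exact: polylim_em_error].
apply: polylim_nsum => l m; apply: polylimM; first exact: polylim_cst.
exact: polylim_ipow.
Qed.

End Continuation.

(** * From depth [r] to depth [r + 1] *)

Section ContinuationStep.
Context {R : realType}.
Local Notation C := R[i].
Variables (r : nat) (lam alp : nat -> R) (F : 'rV[C]_r -> C^o).
Hypothesis alp01 : forall l, 0 <= alp l < 1.
Let lam' := merge_head R lam.
Let alp' (l : nat) := alp l.+1.
Hypothesis FL : forall s, in_domain 0 r s ->
  ccvg (nsum C r (lweight lam' alp' (coordn C _ s))) (F s).
Hypothesis Fp : forall s, poles_at (pole_set r lam') F s.
Variables (k : nat -> C) (delta : bool).
Hypothesis k0 : ~~ delta -> k 0%N = 0.
Hypothesis kE : forall m,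
  \sum_(q < m.+1) k q * ((-1) ^+ (m - q) / (m - q)`!%:R) - unit_exp (lam 0%N) * k m =
  em_rhs (unit_exp (lam 0%N)) (alp 0%N - base_next r alp) m.
Hypothesis deltaE : delta = (lam 0%N \is a Num.int).

Let rterm N (t : 'rV[C]_r.+1) n := rem_term r lam alp k delta N (coordn C _ t) n.

(** Where the series diverges this is the default value 0. *)
Let rem N (t : 'rV[C]_r.+1) : C^o :=
  xget 0 [set l : C | ccvg (fun K => \sum_(n < K) rterm N t n) l].

Lemma rem_cvg N t : in_domain N r.+1 t ->
  ccvg (fun K => \sum_(n < K) rterm N t n) (rem N t).
Proof.
move=> tD.
have [M MB Mb] := rem_term_bound r lam alp k delta alp01 k0 kE N
  (fun l => complex.Re (coordn C _ t l)) (cabs (coordn C _ t 0)) tD.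
have [l Hl] := ccvg_series R (rterm N t) M (Mb _ (fun _ _ => lexx _) (lexx _)) MB.
exact: (@xgetPex _ 0 [set l : C | ccvg (fun K => \sum_(n < K) rterm N t n) l]
  (ex_intro _ l Hl)).
Qed.

Lemma rem_step N t : in_domain N r.+1 t ->
  rem N t = k N * em_factor delta (coordn C _ t 0) N * F (shift_row r N t) + rem
    N.+1 t.
Proof.
move=> tD; apply/eqP; rewrite -subr_eq; apply/eqP.
have h1 := ccvgB _ _ _ _ (rem_cvg N t tD)
  (rem_cvg N.+1 t (in_domain_mono N N.+1 _ t (leqnSn N) tD)).
apply: (ccvg_unique _ _ _ h1).
rewrite (_ : (fun n => _) = (fun K => k N * em_factor delta (coordn C _ t 0) N *
  (nsum C r (lweight lam' alp' (coordn C _ (shift_row r N t))) K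
   - head_power r lam alp (coordn C _ t) N K *
     nsum C r (fun l => lweight lam alp (coordn C _ t) l.+1) K))); last first.
  apply/funext => K; rewrite sum_rem_termS; congr (_ * (_ - _)).
  by apply: nsum_ext => l n lr; rewrite /lweight coord_shift_row.
apply: ccvgZ; rewrite -[F _]subr0; apply: ccvgB.
  by apply: FL; exact: in_domain_shift_row.
apply: head_power_decay => //.
  have := tD 1%N isT; rewrite big_ord1.
  have : N.-1%:R <= (N%:R : R) by rewrite ler_nat leq_pred.
  by move: (N.-1%:R) (N%:R) => a b; lra.
move=> i /andP[i1 ir]; have := tD i.+1 (introT andP (conj (ltn0Sn i) ir)).
rewrite big_ord_recl /= -[i.+1%:R]natr1.
have : N.-1%:R <= (N%:R : R) by rewrite ler_nat leq_pred.
by move: (\sum_(_ < _) _) (N.-1%:R) (N%:R) => a b c; lra.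
Qed.

(** For [delta = true] the quotient has the default value 0 at [s_1 = 1], where [poles_at] with the
    equation of [(1, 0)] asks nothing. *)
Let FN N (t : 'rV[C]_r.+1) : C^o :=
  (\sum_(q < N) k q * em_factor delta (coordn C _ t 0) q * F (shift_row r q t) + rem
    N t)
    / (coordn C _ t 0 - 1) ^+ delta.

Lemma continuation_step N t : in_domain N r.+1 t -> FN N t = FN N.+1 t.
Proof.
by move=> tD; rewrite /FN (rem_step _ _ tD) big_ord_recr /= addrA.
Qed.

Lemma continuation_eq N N' t : in_domain N r.+1 t -> (N <= N')%N -> FN N t = FN N' t.
Proof.
move=> tD; elim: N' => [|N' IH]; first by rewrite leqn0 => /eqP ->.
rewrite leq_eqVlt => /orP[/eqP -> //|NN'].
rewrite IH // continuation_step //.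
exact: in_domain_mono tD.
Qed.

(** For [N = 0] nothing has been subtracted: [rem 0] is [(s_1 - 1)^delta] times the series, and
    [1 < Re s_1] permits the division. *)
Lemma continuation0 t : in_domain 0 r.+1 t ->
  ccvg (nsum C r.+1 (lweight lam alp (coordn C _ t))) (FN 0 t).
Proof.
move=> tD; have := rem_cvg 0 t tD.
under eq_fun do rewrite sum_rem_term0 em_factor1.
rewrite /FN big_ord0 add0r mulrC => h.
have nz : (coordn C r.+1 t 0 - 1) ^+ delta != 0.
  rewrite expf_neq0 // subr_eq0; apply/eqP => t1.
  by have := tD 1%N isT; rewrite big_ord1 t1 /= add0r ltxx.
have := ccvgZ ((coordn C r.+1 t 0 - 1) ^+ delta)^-1 _ _ h.
by congr ccvg; apply/funext => K; rewrite mulKf.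
Qed.

Lemma rem_holomorphic N s : in_domain N r.+1 s -> holomorphic_at (rem N) s.
Proof.
move=> sD; have [rho rho0 [tau tauD taut]] := in_domain_near N r.+1 s sD.
have cl : polylim s rho (fun t => coordn C _ t 0).
  by apply: polylim_poly; exact: polyfun_coordinate.
have [B _ HB] := polylim_bounded _ _ _ cl.
have [M MB Mb] := rem_term_bound r lam alp k delta alp01 k0 kE N tau B tauD.
apply: (polylim_holomorphic s rho) => //.
apply: (polylim_series s rho (fun n t => rterm N t n) M).
- by move=> n; exact: polylim_rem_term.
- by move=> n t ts; apply: Mb => [l _|]; [exact: taut | exact: HB].
- exact: MB.
- move=> t ts; apply: rem_cvg => i ir; apply: lt_le_trans (tauD i ir) _.
  by rewrite lerD2l; apply: ler_sum => l _; exact: taut.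
Qed.

Lemma continuation_poles N s : in_domain N r.+1 s ->
  poles_at (pole_set r.+1 lam) (FN N) s.
Proof.
(* The numerator has poles of index at least 2 only, so that dividing by [s_1 - 1] adds a hyperplane
   not yet present. *)
move=> sD; pose A' : set (nat * nat) := [set p | pole_set r.+1 lam p /\ (2 <= p.1)%N].
have num : poles_at A' (fun t =>
    (\sum_(q < N) k q * em_factor delta (coordn C _ t 0) q * F (shift_row r q t))
    + rem N t : C^o) s.
  apply: poles_atD; last by apply: poles_at_holomorphic; exact: rem_holomorphic.
  (* Terms with [k q = 0] are set aside: for nonintegral [lam 0], the term [q = 0] could contribute
     hyperplanes outside the list. *)
  apply: poles_at_sum => q; have [kq0|kq0] := eqVneq (k q) 0.
    apply: (poles_at_ext _ (fun=> 0)).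
      by near=> t; rewrite kq0 !mul0r.
    by apply: poles_at_holomorphic; exact: holomorphic_cst.
  have eh : holomorphic_at
      (fun t : 'rV[C]_r.+1 => k q * em_factor delta (coordn C _ t 0) q : C^o) s.
    apply: (polylim_holomorphic s 1) => //; apply: polylimM; first exact: polylim_cst.
    by apply: polylim_em_factor; apply: polylim_poly; exact: polyfun_coordinate.
  apply: (poles_atM _ _ (F \o shift_row r q)) => //.
  apply: (poles_at_shift_row _ _ (pole_set r lam')) => //.
    by move=> p [].
  move=> p pA; split; last by case: pA => /andP[].
  apply: pole_set_merge => // l0; rewrite lt0n; apply/eqP => q0.
  by move: kq0; rewrite q0 k0 ?eqxx // deltaE.
have A'A : A' `<=` pole_set r.+1 lam by move=> p [].
have [d1|d0] := boolP delta; last first.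
  apply: (poles_at_ext _ _ _ _ _ (poles_at_sub _ _ _ _ A'A num)).
  by near=> t; rewrite /FN (negbTE d0) expr0 divr1.
have A10 : pole_set r.+1 lam (1%N, 0%N).
  have mu0 : lam 0%N \is a Num.int by rewrite -deltaE.
  have p1 : partial_mu lam 1 = lam 0%N by rewrite /partial_mu big_ord1.
  split => //=; first by rewrite p1.
  by rewrite /int_mu_count big_ord1 p1 mu0.
have A'10 : ~ A' (1%N, 0%N) by case.
apply: (poles_at_ext _ _ _ _ _ (poles_at_div _ _ _ _ _ A'A A10 A'10 num)).
near=> t; rewrite /FN d1 expr1; congr (_ / _).
by rewrite /hyperplane_eqn /= psum_coord // big_ord1 subr0.
Unshelve. all: by end_near. Qed.

Lemma continuation_ex : exists G : 'rV[C]_r.+1 -> C^o,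
  (forall s, in_domain 0 r.+1 s ->
     ccvg (nsum C r.+1 (lweight lam alp (coordn C _ s))) (G s)) /\
  (forall s, poles_at (pole_set r.+1 lam) G s).
Proof.
have [Nt HNt] := choice (@in_domain_ex R r.+1).
have GE N t : in_domain N r.+1 t -> FN (Nt t) t = FN N t.
  move=> tD; have [NN|/ltnW NN] := leqP N (Nt t).
    by rewrite -(continuation_eq N (Nt t)).
  exact: continuation_eq.
exists (fun t => FN (Nt t) t); split => s.
  by move=> sD; rewrite (GE 0%N) //; exact: continuation0.
(* Near [s] the [N] chosen at [s] remains admissible, so the glued function agrees there with a
   single [FN]. *)
have sD := HNt s; apply: (poles_at_ext _ _ _ _ _ (continuation_poles _ _ sD)).
have [rho rho0 [tau tauD taut]] := in_domain_near (Nt s) r.+1 s sD.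
apply/near_norm1P; exists rho => // t ts; apply/esym/GE => i ir.
apply: lt_le_trans (tauD i ir) _.
by rewrite lerD2l; apply: ler_sum => l _; exact: taut.
Qed.

End ContinuationStep.

Lemma continuation (R : realType) r (lam alp : nat -> R) :
  (forall l, 0 <= alp l < 1) ->
  exists F : 'rV[R[i]]_r -> R[i]^o,
    (forall s, in_domain 0 r s ->
       ccvg (nsum R[i] r (lweight lam alp (coordn R[i] _ s))) (F s)) /\
    (forall s, poles_at (pole_set r lam) F s).
Proof.
elim: r lam alp => [|r IH] lam alp alp01.
  exists (fun=> 1); split => s; first by move=> _; exact: ccvg_cst.
  by apply: poles_at_holomorphic; exact: holomorphic_cst.
have [F [FL Fp]] := IH (merge_head R lam) (fun l => alp l.+1) (fun l => alp01 l.+1).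
have [k [k0 kE]] := em_coefficients (unit_exp (lam 0%N)) (alp 0%N - base_next r alp).
apply: (continuation_ex r lam alp F alp01 FL Fp k (lam 0%N \is a Num.int)) => //.
by move=> l0; apply: k0; apply: contraNneq l0 => /unit_exp_eq1.
Qed.

Lemma multiple_lerch_lim (R : realType) r (lam alp : 'rV[R]_r) (s : 'rV[R[i]]_r)
    (L : R[i]) :
  (forall l, 0 <= coordn R r alp l < 1) -> in_domain 0 r s ->
  ccvg (nsum R[i] r (lweight (coordn R r lam) (coordn R r alp) (coordn R[i] r s))) L
    ->
  multiple_lerch lam alp s = L.
Proof.
move=> alp01 sD sL; pose tau l := complex.Re (coordn R[i] r s l).
pose c l : R := expR (`|tau l| * ln 2).
rewrite -(sum_lerch_index r _ (majorant c tau) L _ _ _ sL); first last.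
- apply: nsum_summable => [l|i ir]; first exact: expR_ge0.
  by have := sD i ir; rewrite add0r.
- by move=> l n; apply: majorant_ge0 => ?; exact: expR_ge0.
- by move=> l n _; exact: cabs_lweight.
congr summability.sum; apply/funext => n; apply: eq_bigr => l _.
by rewrite /lweight !coord_ord cpowerV unit_exp_natr.
Qed.

(** By monotonicity every integral index up to [i_ j] is some [i_ j'] with [j' <= j]. *)
Lemma int_mu_count_le (R : realType) (r m j : nat) (lam : 'rV[R]_r) (i_ : nat ->
  nat) :
  (forall j j' : nat,
     (1 <= j)%N -> (j < j')%N -> (j' <= m)%N -> (i_ j < i_ j')%N) ->
  (forall i : nat, ((1 <= i <= r)%N /\ psum lam i \is a Num.int) <->
     exists j : nat, (1 <= j <= m)%N /\ i_ j = i) ->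
  (1 <= j <= m)%N -> (int_mu_count (coordn R r lam) (i_ j) <= j)%N.
Proof.
move=> i_incr i_mu jm.
have [/andP[_ ijr] _] : (1 <= i_ j <= r)%N /\ psum lam (i_ j) \is a Num.int.
  by apply/i_mu; exists j.
pose b a := partial_mu (coordn R r lam) a \is a Num.int.
have -> : int_mu_count (coordn R r lam) (i_ j) = size [seq a <- iota 1 (i_ j) | b a].
  rewrite /int_mu_count -(big_mkord xpredT (fun a => b a.+1 : nat)).
  rewrite -sum1_size big_filter [RHS]big_mkcond (iotaDl 1 0) big_map /index_iota
    subn0.
  by apply: eq_bigr => a _; rewrite add1n; case: (b a.+1).
rewrite -[X in (_ <= X)%N](size_iota 1) -[X in (_ <= X)%N](size_map i_);
  apply: uniq_leq_size.
  by rewrite filter_uniq // iota_uniq.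
move=> a; rewrite mem_filter mem_iota add1n ltnS => /andP[ba /andP[a1 aj]].
have [j' [/andP[j1 j'm] ej']] : exists j', (1 <= j' <= m)%N /\ i_ j' = a.
  apply/i_mu; rewrite a1 (leq_trans aj ijr); split => //.
  by rewrite psum_coord // (leq_trans aj ijr).
apply/mapP; exists j' => //; rewrite mem_iota j1 add1n ltnS /= leqNgt.
apply/negP => jj'; have /andP[h1 _] := jm.
by have := i_incr _ _ h1 jj' j'm; rewrite ej' ltnNge aj.
Qed.

Theorem theorem2 (R : realType) (r : nat) (r_ge1 : (1 <= r)%N)
  (lam alp : 'rV[R]_r)
  (lam01 : forall l : 'I_r, 0 <= lam 0 l < 1)
  (alp01 : forall l : 'I_r, 0 <= alp 0 l < 1)
  (m : nat) (m_ge1 : (1 <= m)%N) (i_ : nat -> nat)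
  (i_incr : forall j j' : nat,
     (1 <= j)%N -> (j < j')%N -> (j' <= m)%N -> (i_ j < i_ j')%N)
  (i_mu : forall i : nat,
     ((1 <= i <= r)%N /\ psum lam i \is a Num.int) <->
     exists j : nat, (1 <= j <= m)%N /\ i_ j = i) :
  (i_ 1%N = 1%N ->
     exists F : 'rV[R[i]]_r -> R[i]^o,
       meromorphic_continuation
         (@lerch_domain R r) (multiple_lerch lam alp) F /\
       possible_simple_poles
         [set p : nat * nat | p = (1%N, 0%N) \/
            exists j k : nat, [/\ (2 <= j <= m)%N, p = (i_ j, k) &
                                  (i_ j)%:Z - k%:Z <= j%:Z]] F) /\
  (i_ 1%N <> 1%N ->
     exists F : 'rV[R[i]]_r -> R[i]^o,
       meromorphic_continuation
         (@lerch_domain R r) (multiple_lerch lam alp) F /\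
       possible_simple_poles
         [set p : nat * nat |
            exists j k : nat, [/\ (1 <= j <= m)%N, p = (i_ j, k) &
                                  (i_ j)%:Z - k%:Z <= j%:Z]] F).
Proof.
have alp01' l : 0 <= coordn R r alp l < 1.
  by rewrite /coordn; case: insubP => [i _ _ //|_]; rewrite lexx ltr01.
have [F [FL Fp]] := continuation R r (coordn R r lam) (coordn R r alp) alp01'.
have Fc : meromorphic_continuation (@lerch_domain R r) (multiple_lerch lam alp) F.
  split; first by apply: poles_at_meromorphic Fp => p [].
  move=> s sD.
  have sD' : in_domain 0 r s.
    move=> i /[dup] ir /andP[_ ir']; rewrite add0r.
    have -> : \sum_(l < i) complex.Re (coordn R[i] r s l) = complex.Re (psum s i).
      by rewrite psum_coord // raddf_sum.
    exact: sD.
  by rewrite (multiple_lerch_lim _ _ _ _ _ _ alp01' sD' (FL s sD')).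
have Fs A : pole_set r (coordn R r lam) `<=` A -> possible_simple_poles A F.
  by move=> sub; apply: poles_at_possible => s; exact: poles_at_sub sub (Fp s).
have polesP p : pole_set r (coordn R r lam) p -> exists j,
    [/\ (1 <= j <= m)%N, p.1 = i_ j & (i_ j)%:Z - p.2%:Z <= j%:Z].
  case: p => i k [/= ir mu le _].
  have [j [jm ij]] : exists j, (1 <= j <= m)%N /\ i_ j = i.
    by apply/i_mu; rewrite psum_coord //; case/andP: ir.
  exists j; split => //; have := int_mu_count_le _ r m j lam i_ i_incr i_mu jm.
  by rewrite ij in le *; move=> cj; rewrite lerBlDr -PoszD lez_nat (leq_trans le) // leq_add2r.
split => i1; exists F; split => //; apply: Fs => p pA.
  have [j [/andP[j1 jm] pj le]] := polesP p pA.
  case: (ltnP 1 j) => [j2|jle].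
    right; exists j, p.2; split => //; first by rewrite j2 jm.
    by rewrite -pj -surjective_pairing.
  (* For [j = 1] the index is [i_1 = 1], and the last clause of [pole_set] leaves only [k = 0]. *)
  have j1' : j = 1%N by apply/eqP; rewrite eqn_leq jle.
  left; case: pA => _ _ _ p10; rewrite j1' i1 in pj.
  by rewrite [p]surjective_pairing pj p10.
have [j [jm pj le]] := polesP p pA.
by exists j, p.2; split => //; rewrite -pj -surjective_pairing.
Qed.
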